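(* Let $Z=(Z_n)_{n\in\mathbb N}$, $Z_n\in\mathbb R^{m_*}$, be independent centred random vectors with $\|Z_{n,i}\|_{L^3}\le M_3(Z)$ for all $n,i$ (some $M_3(Z)\ge1$), and let $G=(G_n)_{n\in\mathbb N}$, $G_n\in\mathbb R^{m_*}$, be independent centred Gaussian vectors with $\mathbb E(G_{n,i}G_{n,j})=\mathbb E(Z_{n,i}Z_{n,j})$ for all $n,i,j$; let $M_3(G)\ge1$ with $\|G_{n,i}\|_{L^3}\le M_3(G)$. Let $c$ be a finitely supported family of real coefficients and $N\in\mathbb N$. Then for every $f\in C_b^3(\mathbb R)$, $$|\mathbb E f(S_N(c,Z))-\mathbb E f(S_N(c,G))|\le \mathcal K_{N,m_*}(Z)\,\|f\|_{3,\infty}\,|c|^2\,\delta_*(c),$$ where $\mathcal K_{N,m_*}(Z)=\frac{2m_*}{3}(M_3^3(Z)+M_3^3(G))\,\overline M_3^{\,3N}$ with $\overline M_3=b_3\sqrt{m_*}\,(M_3(Z)\vee M_3(G))$.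
   Context: Multi-indices: for $m\ge0$, a multi-index of length $|\alpha|=m$ is $\alpha=(\alpha_1,\dots,\alpha_m)$ with $\alpha_i=(\alpha_i',\alpha_i'')\in\mathbb N\times[m_*]$ and $\alpha_1'<\dots<\alpha_m'$; $\emptyset$ has length $0$. $x^\alpha=\prod_i x_{\alpha_i',\alpha_i''}$, $x^\emptyset=1$. For real coefficients $c(\alpha)$ (finitely many nonzero), $S_N(c,x)=\sum_{0\le|\alpha|\le N}c(\alpha)x^\alpha$, $|c|^2=\sum_{|\alpha|\le N}c(\alpha)^2$, and the influence factor is $\delta_*(c)=\big(\sup_n\sum_{\alpha:\,n\in\{\alpha_1',\dots,\alpha_{|\alpha|}'\}}c(\alpha)^2\big)^{1/2}$. $\|f\|_{3,\infty}$ is the sup of $|f|,|f'|,|f''|,|f'''|$. $b_3\ge1$ is the constant in Burkholder's inequality in $L^3$ for real martingales. *)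

(* Defs.v *)
From HB Require Import structures.
From mathcomp Require Import all_boot all_order all_algebra.
From mathcomp Require Import all_classical all_reals all_analysis.
Set Implicit Arguments. Unset Strict Implicit. Unset Printing Implicit Defensive.
Import Order.TTheory GRing.Theory Num.Theory.
Import numFieldNormedType.Exports.
Local Open Scope classical_set_scope.
Local Open Scope ring_scope.

Definition mindex (m : nat) := seq (nat * 'I_m).
Definition is_mindex (m : nat) (a : mindex m) : bool :=
  sorted (fun p q : nat => (p < q)%N) (map fst a).

Section Poly.
Variables (R : realType) (m : nat).

Definition xpow (x : nat -> 'I_m -> R) (a : mindex m) : R :=
  \prod_(p <- a) x p.1 p.2.

Definition SN (N : nat) (c : mindex m -> R) (x : nat -> 'I_m -> R) : R :=
  \sum_(a \in [set a : mindex m | is_mindex a /\ (size a <= N)%N])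
     c a * xpow x a.

Definition csq (N : nat) (c : mindex m -> R) : R :=
  \sum_(a \in [set a : mindex m | is_mindex a /\ (size a <= N)%N]) c a ^+ 2.

Definition influence (c : mindex m -> R) : R :=
  Num.sqrt (sup (range (fun n : nat =>
    \sum_(a \in [set a : mindex m | is_mindex a /\ n \in map fst a]) c a ^+ 2))).
End Poly.

Definition norm3inf (R : realType) (f : R -> R) : R :=
  sup [set y : R | exists k x, (k <= 3)%N /\ y = `|derive1n k f x|].

Definition Cb3 (R : realType) (f : R -> R) : Prop :=
  (forall k x, (k < 3)%N -> derivable (derive1n k f) x 1) /\
  continuous (derive1n 3 f) /\
  (exists B : R, forall k x, (k <= 3)%N -> `|derive1n k f x| <= B).

Section Prob.
Context {R : realType} {d : measure_display} {T : measurableType d}.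
Variable (P : probability T R).

(* mutual independence of the random vectors (X n)_{n in N}, X n : T -> R^m,
   via the product rule on (measurable) rectangles over finite sets of indices *)
Definition indep_vectors (m : nat) (X : nat -> 'I_m -> T -> R) : Prop :=
  forall (s : seq nat) (B : nat -> 'I_m -> set R),
    uniq s -> (forall n i, measurable (B n i)) ->
    P (\bigcap_(n in [set n | n \in s]) [set w | forall i, B n i (X n i w)]) =
    (\prod_(n <- s) P [set w | forall i, B n i (X n i w)])%E.

(* centred real Gaussian variable (possibly degenerate, i.e. a.s. 0) *)
Definition centred_gaussian (Y : T -> R) : Prop :=
  P (Y @^-1` [set 0]) = 1%E \/
  exists s : R, 0 < s /\
    forall A : set R, measurable A -> P (Y @^-1` A) = normal_prob 0 s A.

Definition centred_gaussian_vector (m : nat) (Y : 'I_m -> T -> R) : Prop :=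
  forall a : 'I_m -> R, centred_gaussian (fun w => \sum_i a i * Y i w).
End Prob.

(* b is a constant for Burkholder's inequality in L^3 for real martingales:
   for every martingale difference sequence (X k) w.r.t. a filtration (F k),
   || sum_{k<=n} X k ||_3 <= b || (sum_{k<=n} X k^2)^{1/2} ||_3. *)
Definition burkholder3 (R : realType) (b : R) : Prop :=
  forall (d : measure_display) (T : measurableType d) (P : probability T R)
    (F : nat -> set (set T)) (X : nat -> T -> R) (n : nat),
    (forall k, sigma_algebra setT (F k)) ->
    (forall k, F k `<=` measurable) ->
    (forall k, F k `<=` F k.+1) ->
    (forall k (B : set R), measurable B -> F k (X k @^-1` B)) ->
    (forall k, P.-integrable setT (EFin \o X k)) ->
    (forall k A, F k A -> (\int[P]_(w in A) (X k.+1 w)%:E = 0)%E) ->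
    (Lnorm P 3%:E (EFin \o (fun w => (\sum_(k < n.+1) X k w)%R)) <=
      b%:E * Lnorm P 3%:E
        (EFin \o (fun w => Num.sqrt (\sum_(k < n.+1) X k w ^+ 2)%R)))%E.

(* Main.v *)
(* Lindeberg's method on the product space: the vectors Z_n are exchanged for the G_n
   one at a time.  The polynomial S_N has the form A + sum_i x_{n,i} B_i, where A and the
   B_i do not involve the n-th vector, so by independence and equality of the first two
   moments the Taylor expansion at A leaves only a remainder controlled by
   E|sum_i Z_{n,i} B_i|^3 and E|sum_i G_{n,i} B_i|^3.

   The cubic norm of B_i is at most (3/2 sqrt(m) M)^(N-1) times the l^2 norm of its
   coefficients, by iterating, variable by variable, the inequality
   ||A + Y||_3^2 <= ||A||_3^2 + 9/4 ||Y||_3^2, valid when E[|A| A Y] = 0.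

   Summing over n counts every coefficient once for each of its at most N indices.  This
   factor N cannot be absorbed if Burkholder's inequality with constant b itself is
   iterated; but any such b satisfies b^3 >= 73/20 > (3/2)^3, as a suitable stopped
   martingale shows, and N is dominated by the N-th power of the quotient. *)

Require Import Defs.
From HB Require Import structures.
From mathcomp Require Import all_boot all_order all_algebra.
From mathcomp Require Import all_classical all_reals all_analysis.
From mathcomp Require Import measurable_realfun ring lra.
Set Implicit Arguments. Unset Strict Implicit. Unset Printing Implicit Defensive.
Import Order.TTheory GRing.Theory Num.Theory.
Import numFieldNormedType.Exports.
Local Open Scope classical_set_scope.
Local Open Scope ring_scope.

(** The coordinates of one vector may be dependent. Orthogonality is thus available only between
    different indices n; inside one vector the triangle inequality and Cauchy-Schwarz are used, at
    the price of sqrt(m) per degree. One exchange leaves a remainder of order w^(3/2), where w is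
    the sum of c(alpha)^2 over the multi-indices containing n. One root of w is bounded by the
    influence factor, and the remaining w is summed over n. As to constants, the Taylor remainder
    brings 1/6 where the claim has 2/3: a factor 4 is spare. The B_i have degree at most N-1 and the
    claim has the power 3N: a factor (b sqrt(m) M)^3 is spare too. The linear form in the exchanged
    vector contributes m^(3/2); its part m is the m of the claim, and the spare power pays for the
    rest. What remains is to beat N by 4 b^3 (8 b^3 / 27)^(N-1), and a margin of eight percent of
    b^3 over 27/8 is enough for that. *)

(** * Expectation of a product of two independent variables *)

Section independent_product.
Context {R : realType} {d : measure_display} {T : measurableType d}.
Variable P : probability T R.

Definition indep_pair (U V : T -> R) : Prop := forall A B : set R,
  measurable A -> measurable B ->
  (P (U @^-1` A `&` V @^-1` B) = P (U @^-1` A) * P (V @^-1` B))%E.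

Variables U V : T -> R.
Hypotheses (mU : measurable_fun setT U) (mV : measurable_fun setT V).
Hypothesis UV : indep_pair U V.

Let UR : {RV P >-> R} := HB.pack U (isMeasurableFun.Build _ _ _ _ U mU).
Let VR : {RV P >-> R} := HB.pack V (isMeasurableFun.Build _ _ _ _ V mV).
Let W (w : T) : R * R := (U w, V w).
Let mW : measurable_fun setT W.
Proof. exact: measurable_fun_pair. Qed.
Let WR : {RV P >-> (R * R)%type} := HB.pack W (isMeasurableFun.Build _ _ _ _ W mW).

Let joint_lawE (C : set (R * R)) : measurable C ->
  (distribution P UR \x distribution P VR)%E C = distribution P WR C.
Proof.
by move=> mC; exact: product_measure_unique.
Qed.

(** By [joint_lawE] the law of [(U, V)] is the product of the marginal laws, and Tonelli's theorem
    separates the variables. The absolute value in [g] makes the integrand nonnegative on the whole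
    plane and not merely on the range of [(U, V)]. *)
Lemma indep_ge0_integralM : (forall w, 0 <= U w) -> (forall w, 0 <= V w) ->
  (\int[P]_w (U w * V w)%:E = \int[P]_w (U w)%:E * \int[P]_w (V w)%:E)%E.
Proof.
move=> U0 V0.
pose g : (R * R)%type -> \bar R := fun z => `|z.1 * z.2|%:E.
have mg : measurable_fun [set: (R * R)%type] g.
  apply/measurable_EFinP; apply: measurableT_comp => //.
  exact: measurable_funM.
have -> : (\int[P]_w (U w * V w)%:E = \int[P]_w (g \o WR) w)%E.
  by apply: eq_integral => w _; rewrite /g /= ger0_norm// mulr_ge0.
rewrite -ge0_integral_distribution//; last by move=> z; rewrite lee_fin.
rewrite (eq_measure_integral (distribution P UR \x distribution P VR)%E); last first.
  by move=> C mC _; exact/esym/joint_lawE.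
rewrite fubini_tonelli1//; last by move=> z; rewrite lee_fin.
have mabs : measurable_fun [set: R] (fun x : R => `|x|%:E).
  by apply/measurable_EFinP; exact: normr_measurable.
have -> : (fubini_F (distribution P VR) g =
    fun x => `|x|%:E * \int[distribution P VR]_y `|y|%:E)%E.
  apply/funext => x; rewrite /fubini_F /g /=.
  under eq_integral => y _ do rewrite normrM EFinM.
  by rewrite ge0_integralZl// => *; rewrite lee_fin.
rewrite ge0_integralZr//; last exact: integral_ge0.
rewrite !ge0_integral_distribution// /comp.
by congr (_ * _)%E; apply: eq_integral => w _ /=; rewrite ger0_norm.
Qed.

End independent_product.

Section independent_product_signed.
Context {R : realType} {d : measure_display} {T : measurableType d}.
Variable P : probability T R.

Lemma indep_pair_comp (U V : T -> R) (g h : R -> R) : measurable_fun setT g ->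
  measurable_fun setT h -> indep_pair P U V -> indep_pair P (g \o U) (h \o V).
Proof.
move=> mg mh UV A B mA mB.
have mgA : measurable (g @^-1` A) by rewrite -(setTI (g @^-1` A)); exact: mg.
have mhB : measurable (h @^-1` B) by rewrite -(setTI (h @^-1` B)); exact: mh.
exact: UV mgA mhB.
Qed.

(** The nonnegative case applied to |U| and |V| gives a finite product of first moments; no second
    moment enters. *)
Lemma indep_integrableM (U V : T -> R) :
  P.-integrable setT (EFin \o U) -> P.-integrable setT (EFin \o V) ->
  indep_pair P U V -> P.-integrable setT (fun w => (U w * V w)%:E).
Proof.
move=> iU iV UV.
have mU : measurable_fun setT U by apply/measurable_EFinP; exact: measurable_int iU.
have mV : measurable_fun setT V by apply/measurable_EFinP; exact: measurable_int iV.
apply/integrableP; split; first by apply/measurable_EFinP; exact: measurable_funM.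
under eq_integral => w _ do rewrite /= normrM.
have mn : measurable_fun [set: R] (fun x : R => `|x|) by exact: normr_measurable.
rewrite (indep_ge0_integralM _ _ (indep_pair_comp mn mn UV)); last 4 first.
- exact: (measurableT_comp mn mU).
- exact: (measurableT_comp mn mV).
- by move=> w /=.
- by move=> w /=.
move/integrableP : iU => [_ iU]; move/integrableP : iV => [_ iV].
have I0 (f : T -> R) : (0 <= \int[P]_w `|f w|%:E)%E.
  by apply: integral_ge0 => w _; rewrite lee_fin.
by apply: lte_mul_pinfty; [exact: I0|rewrite ge0_fin_numE//; exact: I0|].
Qed.

Lemma indep_integralM (U V : T -> R) :
  P.-integrable setT (EFin \o U) -> P.-integrable setT (EFin \o V) ->
  indep_pair P U V ->
  (\int[P]_w (U w * V w)%:E = \int[P]_w (U w)%:E * \int[P]_w (V w)%:E)%E.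
Proof.
move=> iU iV UV.
have iUV := indep_integrableM iU iV UV.
have mU : measurable_fun setT U by apply/measurable_EFinP; exact: measurable_int iU.
have mV : measurable_fun setT V by apply/measurable_EFinP; exact: measurable_int iV.
have iN (f : T -> R) : P.-integrable setT (EFin \o f) ->
    P.-integrable setT (EFin \o (fun w => `|f w|)).
  by move=> /integrable_abse.
have split_int (f : T -> R) : P.-integrable setT (EFin \o f) ->
    (\int[P]_w (f w)%:E = \int[P]_w (f w + `|f w|)%:E - \int[P]_w `|f w|%:E)%E.
  move=> i_f; rewrite -integralB_EFin//; last 2 first.
  - exact: integrableD i_f (iN _ i_f).
  - exact: iN.
  by apply: eq_integral => w _; rewrite -EFinB addrK.
have fin (f : T -> R) : P.-integrable setT (EFin \o f) ->
    (\int[P]_w (f w)%:E \is a fin_num)%E.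
  by move=> i_f; exact: integrable_fin_num.
have iD (f : T -> R) : P.-integrable setT (EFin \o f) ->
    P.-integrable setT (EFin \o (fun w => f w + `|f w|)).
  by move=> i_f; exact: integrableD i_f (iN _ i_f).
have p0 (x : R) : 0 <= x + `|x|.
  by rewrite -lerBlDl sub0r -normrN ler_norm.
have mn : measurable_fun [set: R] (fun x : R => `|x|) by exact: normr_measurable.
have mp : measurable_fun [set: R] (fun x : R => x + `|x|) by exact: measurable_funD.
pose I f := fine (\int[P]_w (f w)%:E)%E.
have IE (f : T -> R) : P.-integrable setT (EFin \o f) -> (\int[P]_w (f w)%:E = (I f)%:E)%E.
  by move=> i_f; rewrite fineK//; exact: fin.
(* bilinear expansion of (U + |U| - |U|)(V + |V| - |V|) into products of nonnegative functions *)
have prodE (g h : R -> R) : measurable_fun setT g -> measurable_fun setT h ->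
    (forall x, 0 <= g x) -> (forall x, 0 <= h x) ->
    P.-integrable setT (EFin \o (g \o U)) -> P.-integrable setT (EFin \o (h \o V)) ->
    P.-integrable setT (EFin \o (fun w => g (U w) * h (V w))) /\
    I (fun w => g (U w) * h (V w)) = I (g \o U) * I (h \o V).
  move=> mg mh g0 h0 ig ih.
  have gh := indep_pair_comp mg mh UV.
  have igh := indep_integrableM ig ih gh; split => //.
  apply: EFin_inj; rewrite EFinM -!IE//.
  by apply: indep_ge0_integralM => //; exact: measurableT_comp.
have [i1 E1] := prodE _ _ mp mp p0 p0 (iD _ iU) (iD _ iV).
have [i2 E2] := prodE _ _ mp mn p0 (fun x => normr_ge0 x) (iD _ iU) (iN _ iV).
have [i3 E3] := prodE _ _ mn mp (fun x => normr_ge0 x) p0 (iN _ iU) (iD _ iV).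
have [i4 E4] := prodE _ _ mn mn (fun x => normr_ge0 x) (fun x => normr_ge0 x) (iN _ iU) (iN _ iV).
have IB (f g : T -> R) : P.-integrable setT (EFin \o f) -> P.-integrable setT (EFin \o g) ->
    I (fun w => f w - g w) = I f - I g.
  move=> i_f ig; apply: EFin_inj; rewrite EFinB -!IE//; last exact: (integrableB measurableT i_f ig).
  exact: integralB_EFin.
have iB (f g : T -> R) : P.-integrable setT (EFin \o f) -> P.-integrable setT (EFin \o g) ->
    P.-integrable setT (EFin \o (fun w => f w - g w)).
  by move=> i_f ig; exact: (integrableB measurableT i_f ig).
rewrite !IE// -EFinM; congr EFin.
have -> : (fun w => U w * V w) = (fun w =>
   (((U w + `|U w|) * (V w + `|V w|) - (U w + `|U w|) * `|V w|)
   - (`|U w| * (V w + `|V w|) - `|U w| * `|V w|))).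
  by apply/funext => w; ring.
rewrite IB; [|exact: iB|exact: iB].
rewrite !IB//; rewrite E1 E2 E3 E4.
have -> : I U = I (fun w => U w + `|U w|) - I (fun w => `|U w|).
  by rewrite -IB; [congr I; apply/funext => w; rewrite addrK|exact: iD|exact: iN].
have -> : I V = I (fun w => V w + `|V w|) - I (fun w => `|V w|).
  by rewrite -IB; [congr I; apply/funext => w; rewrite addrK|exact: iD|exact: iN].
rewrite /comp; ring.
Qed.

End independent_product_signed.

(** * Independence of the sigma-algebras generated by disjoint blocks of vectors *)

Section generated_sigma_algebras.
Context {R : realType} {d : measure_display} {T : measurableType d}.
Variables (P : probability T R) (m : nat) (X : nat -> 'I_m -> T -> R).
Hypothesis mX : forall n i, measurable_fun setT (X n i).

Definition cylinder (s : seq nat) (B : nat -> 'I_m -> set R) : set T :=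
  [set w | forall n, n \in s -> forall i, B n i (X n i w)].

Definition cylinders (S : pred nat) : set_system T :=
  [set A | exists s B, [/\ uniq s, all S s,
     (forall n i, measurable (B n i)) & A = cylinder s B]].

Lemma cylinder_bigcap s B :
  cylinder s B = \bigcap_(n in [set n | n \in s]) [set w | forall i, B n i (X n i w)].
Proof. by apply/seteqP; split=> w /= + n /= ns; move/(_ n ns). Qed.

Lemma cylinders_measurable S : cylinders S `<=` measurable.
Proof.
move=> _ [s [B [_ _ mB ->]]].
rewrite cylinder_bigcap; apply: fin_bigcap_measurable.
  by apply/finite_seqP; exists s.
move=> n _.
rewrite (_ : [set _ | _] = \bigcap_(i in [set: 'I_m]) (X n i @^-1` B n i)); last first.
  by apply/seteqP; split=> w /= + i; move/(_ i) => // /(_ I).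
apply: fin_bigcap_measurable; first exact: finite_finset.
by move=> i _; rewrite -(setTI (X n i @^-1` _)); exact: mX.
Qed.

Lemma cylinders_setI S : setI_closed (cylinders S).
Proof.
move=> _ _ [s [B [us Ss mB ->]]] [t [C [ut St mC ->]]].
(* The list of a cylinder must be duplicate-free, hence [undup]; an index absent from one of the
   lists is left unconstrained there by [setT]. *)
exists (undup (s ++ t)), (fun n i => (if n \in s then B n i else setT) `&`
                                     (if n \in t then C n i else setT)).
split.
- exact: undup_uniq.
- apply/allP => n; rewrite mem_undup mem_cat => /orP[].
    exact: (allP Ss).
  exact: (allP St).
- by move=> n i; apply: measurableI; case: ifP.
apply/seteqP; split => w /=.
  move=> [sB tC] n _ i; split; case: ifPn => // nin; [exact: sB|exact: tC].
move=> H; split=> n nin i; have := H n _ i;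
  rewrite mem_undup mem_cat nin ?orbT => /(_ isT)[] //.
Qed.

Lemma cylindersT S : cylinders S setT.
Proof.
exists [::], (fun _ _ => setT); split => //.
by apply/seteqP; split.
Qed.

(** The sigma-algebra generated by the vectors [X n] with [n] in [S], placed on the carrier of [T]:
    to depend on these vectors only becomes plain measurability of a function with source
    [obs S]. *)
Definition obs (S : pred nat) := g_sigma_algebraType (cylinders S).

Lemma obs_measurable (S : pred nat) (A : set T) : (@measurable _ (obs S)) A -> measurable A.
Proof.
move=> SA.
exact: (smallest_sub (@sigma_algebra_measurable _ T) (@cylinders_measurable S) SA).
Qed.

Lemma obs_measurable_fun d' (T' : measurableType d') (S : pred nat) (V : T -> T') :
  measurable_fun setT (V : obs S -> T') -> measurable_fun setT V.
Proof.
move=> mV _ B mB; rewrite setTI; apply: (@obs_measurable S).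
by rewrite -(setTI (V @^-1` B)); exact: mV.
Qed.

Lemma obs_coord (S : pred nat) n i : S n ->
  measurable_fun setT (X n i : obs S -> R).
Proof.
move=> Sn _ B mB; rewrite setTI; apply: sub_sigma_algebra.
exists [:: n], (fun _ j => if j == i then B else setT); split => //=.
- by rewrite Sn.
- by move=> _ j; case: ifP.
apply/seteqP; split => w /=.
  by move=> Bw _ /[!inE] /eqP -> j; case: eqP => // ->.
by move/(_ n); rewrite inE eqxx => /(_ isT i); rewrite eqxx.
Qed.

Hypothesis iX : indep_vectors P X.

Lemma cylinder_prod s B : uniq s -> (forall n i, measurable (B n i)) ->
  P (cylinder s B) = (\prod_(n <- s) P [set w | forall i, B n i (X n i w)])%E.
Proof. by move=> us mB; rewrite cylinder_bigcap iX. Qed.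

(** Disjointness of the index sets makes the concatenated list duplicate-free, so the intersection
    is again a cylinder and its probability is the product over both lists. *)
Lemma cylinders_indep (S S' : pred nat) A A' : (forall n, S n -> ~~ S' n) ->
  cylinders S A -> cylinders S' A' -> (P (A `&` A') = P A * P A')%E.
Proof.
move=> SS' [s [B [us Ss mB ->]]] [t [C [ut St mC ->]]].
pose D n := if n \in s then B n else C n.
have st n : n \in t -> n \notin s.
  by move=> nt; apply/negP => ns; have := SS' n (allP Ss _ ns); rewrite (allP St _ nt).
have -> : cylinder s B `&` cylinder t C = cylinder (s ++ t) D.
  apply/seteqP; split => w /=.
    move=> [sB tC] n; rewrite mem_cat /D => /orP[ns|nt] i; first by rewrite ns; exact: sB.
    by rewrite (negbTE (st _ nt)); exact: tC.
  move=> H; split => n nin i; have := H n; rewrite mem_cat nin ?orbT /D => /(_ isT i).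
    by rewrite nin.
  by rewrite (negbTE (st _ nin)).
rewrite !cylinder_prod//; last 2 first.
- rewrite cat_uniq us ut andbT/=; apply/hasPn => n nt; exact: st.
- by move=> n i; rewrite /D; case: ifP.
rewrite big_cat/=; congr (_ * _)%E; rewrite big_seq [RHS]big_seq; apply: eq_bigr => n nin.
  by rewrite /D nin.
by rewrite /D (negbTE (st _ nin)).
Qed.

Lemma obs_indep (S S' : pred nat) (A A' : set T) : (forall n, S n -> ~~ S' n) ->
  (@measurable _ (obs S)) A -> (@measurable _ (obs S')) A' ->
  (P (A `&` A') = P A * P A')%E.
Proof.
move=> SS' SA SA'.
(* pi-lambda on each side in turn *)
have ext (S1 : pred nat) (E : set T) : measurable E ->
    (forall B, cylinders S1 B -> (P (B `&` E) = P B * P E)%E) ->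
    forall B, @measurable _ (obs S1) B -> (P (B `&` E) = P B * P E)%E.
  move=> mE cE B SB.
  (* The finite measures B -> P(B and E) and B -> P(E) P(B) are compared on the pi-system of
     cylinders; [k] is P(E) in the form required by [mscale]. *)
  pose k : {nonneg R} := NngNum (fine_ge0 (measure_ge0 P E)).
  have kE : (k%:num%:E = P E)%E by rewrite /= fineK// fin_num_measure.
  have key := @g_sigma_algebra_measure_unique _ R T (cylinders S1)
    (@cylinders_measurable S1) (fun=> setT) (fun=> cylindersT S1)
    _ (mrestr P mE) (mscale k P) (@cylinders_setI S1) _ _ B SB.
  rewrite [RHS]muleC -kE; apply: key.
  - by apply/seteqP; split => // w _; exists 0%N.
  - by move=> C SC; rewrite [LHS]cE// muleC -kE.
  - by move=> _; rewrite /= /mrestr setTI -ge0_fin_numE// fin_num_measure.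
apply: (ext _ _ (obs_measurable SA') _ _ SA).
move=> B SB; rewrite setIC [RHS]muleC.
apply: (ext _ _ (cylinders_measurable SB) _ _ SA').
by move=> C SC; rewrite setIC muleC; exact: (cylinders_indep SS').
Qed.

Lemma obs_indep_pair (S S' : pred nat) (U V : T -> R) : (forall n, S n -> ~~ S' n) ->
  measurable_fun setT (U : obs S -> R) -> measurable_fun setT (V : obs S' -> R) ->
  indep_pair P U V.
Proof.
move=> SS' mU mV A B mA mB; apply: (obs_indep SS').
  by rewrite -(setTI (U @^-1` A)); exact: mU.
by rewrite -(setTI (V @^-1` B)); exact: mV.
Qed.

End generated_sigma_algebras.

(** * Elementary inequalities for cubes *)

Section real_inequalities.
Variable R : realType.
Implicit Types a b x y z : R.

(** Young's inequality for the exponents 3 and 3/2, the pointwise source of [L3_hoelder]. *)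
Lemma young3 a b : 0 <= a -> 0 <= b -> a * b ^+ 2 <= a ^+ 3 / 3 + 2 * b ^+ 3 / 3.
Proof.
move=> a0 b0.
have : 0 <= (a - b) ^+ 2 * (a + 2 * b) / 3 by rewrite divr_ge0// mulr_ge0 ?sqr_ge0//; lra.
move=> h; rewrite -subr_ge0; suff -> : a ^+ 3 / 3 + 2 * b ^+ 3 / 3 - a * b ^+ 2 = (a - b) ^+ 2 * (a + 2 * b) / 3 by [].
by field.
Qed.

(** By symmetry a is nonnegative. If a + y is too, this is the binomial formula with y^3 replaced by
    its absolute value; otherwise the difference is a times a nonnegative quadratic form. The
    first-order term keeps its sign, so that it can vanish in the mean. *)
Lemma normr_cube_add a y :
  `|a + y| ^+ 3 <= `|a| ^+ 3 + 3 * (`|a| * a * y) + 3 * (`|a| * y ^+ 2) + `|y| ^+ 3.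
Proof.
wlog a0 : a y / 0 <= a => [H|].
  have [|a0] := leP 0 a; first exact: H.
  have := H (- a) (- y); rewrite oppr_ge0 -opprD !normrN sqrrN.
  have -> : `|a| * - a * - y = `|a| * a * y by ring.
  by apply; exact: ltW.
rewrite (ger0_norm a0).
have [ay0|ay0] := leP 0 (a + y).
  rewrite (ger0_norm ay0); have : y ^+ 3 <= `|y| ^+ 3 by rewrite -normrX ler_norm.
  by move=> y3; lra.
rewrite (ltr0_norm ay0); have -> : `|y| = - y by rewrite ltr0_norm//; lra.
rewrite -subr_ge0.
have -> : a ^+ 3 + 3 * (a * a * y) + 3 * (a * y ^+ 2) + (- y) ^+ 3 - (- (a + y)) ^+ 3 =
  a * (3 / 2 * (a + 2 * y) ^+ 2 + a ^+ 2 / 2) by field.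
have := sqr_ge0 (a + 2 * y); have := sqr_ge0 a => ? ?.
by rewrite mulr_ge0//; lra.
Qed.

(** Squaring turns the claim into nonnegativity of a form of degree six. With a constant k in place
    of 9/4 its lowest term in y is (3k - 6) x^4 y^2, so k must exceed 2; for 9/4 the form is y^2
    times visibly nonnegative terms. *)
Lemma sqrt_cube_bound x y z : 0 <= x -> 0 <= y -> 0 <= z ->
  z ^+ 2 = x ^+ 2 + 9 / 4 * y ^+ 2 -> x ^+ 3 + 3 * (x * y ^+ 2) + y ^+ 3 <= z ^+ 3.
Proof.
move=> x0 y0 z0 zE.
rewrite -ler_sqr ?nnegrE ?exprn_ge0//; last first.
  by rewrite !addr_ge0 ?exprn_ge0// mulr_ge0// mulr_ge0// exprn_ge0.
rewrite -exprM mulnC exprM zE -subr_ge0.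
have -> : (x ^+ 2 + 9 / 4 * y ^+ 2) ^+ 3 - (x ^+ 3 + 3 * (x * y ^+ 2) + y ^+ 3) ^+ 2 =
  y ^+ 2 * (3 / 4 * (x ^+ 2 - 4 / 3 * (x * y)) ^+ 2 +
    y ^+ 2 * (233 / 48 * x ^+ 2 - 6 * (x * y) + 665 / 64 * y ^+ 2)) by field.
apply: mulr_ge0; first exact: sqr_ge0.
have h1 := sqr_ge0 (x ^+ 2 - 4 / 3 * (x * y)).
have h2 : 0 <= y ^+ 2 * (233 / 48 * x ^+ 2 - 6 * (x * y) + 665 / 64 * y ^+ 2).
  apply: mulr_ge0; first exact: sqr_ge0.
  by have := sqr_ge0 (2 * x - 3 / 2 * y); have := sqr_ge0 x; have := sqr_ge0 y; lra.
by apply: addr_ge0 => //; apply: mulr_ge0 => //; lra.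
Qed.

End real_inequalities.

(** * Calculus of third moments *)

Section third_moments.
Context {R : realType} {d : measure_display} {T : measurableType d}.
Variable P : probability T R.
Implicit Types (f g A Y : T -> R) (x y : R).

Definition integ f := P.-integrable setT (EFin \o f).

Lemma integ_measurable f : integ f -> measurable_fun setT f.
Proof. by move=> i; apply/measurable_EFinP; exact: measurable_int i. Qed.

Lemma integ_le f g : measurable_fun setT f -> integ g ->
  (forall w, `|f w| <= g w) -> integ f.
Proof.
move=> mf ig fg; apply: le_integrable ig => //; first exact/measurable_EFinP.
by move=> w _; rewrite /= lee_fin (le_trans (fg w))// ler_norm.
Qed.

Lemma measurable_norm f : measurable_fun setT f -> measurable_fun setT (fun w => `|f w|).
Proof. by move=> mf; exact: (measurableT_comp (@normr_measurable R setT) mf). Qed.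

Lemma integD f g : integ f -> integ g -> integ (fun w => f w + g w).
Proof. by move=> i_f ig; exact: (integrableD measurableT i_f ig). Qed.

Lemma integB f g : integ f -> integ g -> integ (fun w => f w - g w).
Proof. by move=> i_f ig; exact: (integrableB measurableT i_f ig). Qed.

Lemma integZ k f : integ f -> integ (fun w => k * f w).
Proof. by move=> i_f; exact: (integrableZl measurableT k i_f). Qed.

Lemma integ_cst k : integ (fun=> k).
Proof. exact: finite_measure_integrable_cst. Qed.

Lemma integ_sum (I : Type) (s : seq I) (h : I -> T -> R) :
  (forall i, integ (h i)) -> integ (fun w => \sum_(i <- s) h i w).
Proof.
move=> ih; elim: s => [|i s IH].
  by rewrite (_ : (fun _ => _) = fun=> 0); [exact: integ_cst|apply/funext => w; rewrite big_nil].
rewrite (_ : (fun _ => _) = fun w => h i w + \sum_(j <- s) h j w).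
  exact: integD.
by apply/funext => w; rewrite big_cons.
Qed.

Lemma mean_sum (I : Type) (s : seq I) (h : I -> T -> R) :
  (forall i, integ (h i)) ->
  \int[P]_w (\sum_(i <- s) h i w) = \sum_(i <- s) \int[P]_w h i w.
Proof.
move=> ih; elim: s => [|i s IH].
  rewrite big_nil (_ : (fun _ => _) = fun=> 0); last by apply/funext => w; rewrite big_nil.
  by rewrite Rintegral_cst// mul0r.
rewrite big_cons -IH -(RintegralD measurableT (ih i) (integ_sum s ih)).
by apply: eq_Rintegral => w _; rewrite big_cons.
Qed.

Lemma mean_EFin f : integ f -> (\int[P]_w (f w)%:E = (\int[P]_w f w)%:E)%E.
Proof. by move=> i_f; rewrite /Rintegral fineK//; exact: integrable_fin_num. Qed.

(** For nonnegative [x] this says that the L^3 norm is at most [x]. Bounding the cube by a real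
    number avoids roots and infinite values. *)
Definition L3 f x := [/\ measurable_fun setT f, integ (fun w => `|f w| ^+ 3) &
  \int[P]_w (`|f w| ^+ 3) <= x ^+ 3].

Lemma L3_le f x y : 0 <= x -> x <= y -> L3 f x -> L3 f y.
Proof.
by move=> x0 xy [mf i_f fx]; split => //; rewrite (le_trans fx)// lerXn2r ?nnegrE// (le_trans x0).
Qed.

Lemma integ_mul_sqr A Y x y : L3 A x -> L3 Y y -> integ (fun w => `|A w| * Y w ^+ 2).
Proof.
move=> [mA iA _] [mY iY _].
apply: (@integ_le _ (fun w => `|A w| ^+ 3 + `|Y w| ^+ 3)); last 2 first.
- exact: integD.
- move=> w; rewrite normrM normr_id normrX.
  have h1 := young3 (normr_ge0 (A w)) (normr_ge0 (Y w)); rewrite (le_trans h1)//.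
  have := exprn_ge0 3 (normr_ge0 (A w)); have := exprn_ge0 3 (normr_ge0 (Y w)); lra.
- apply: measurable_funM; last exact: measurable_funX.
  exact: measurable_norm.
Qed.

Lemma L3_hoelder A Y x y : 0 <= x -> 0 <= y -> L3 A x -> L3 Y y ->
  \int[P]_w (`|A w| * Y w ^+ 2) <= x * y ^+ 2.
Proof.
have pos u v : 0 < u -> 0 < v -> L3 A u -> L3 Y v ->
    \int[P]_w (`|A w| * Y w ^+ 2) <= u * v ^+ 2.
  move=> u0 v0 LA LY; have iAY := integ_mul_sqr LA LY; have [_ iA Au] := LA; have [_ iY Yv] := LY.
  (* These are the coefficients obtained by applying [young3] to |A|/u and |Y|/v and multiplying by
     u v^2. *)
  pose a := v ^+ 2 / (3 * u ^+ 2); pose b := 2 * u / (3 * v).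
  have a0 : 0 <= a by rewrite /a; apply: divr_ge0; [exact: sqr_ge0|apply: mulr_ge0 => //; exact: sqr_ge0].
  have b0 : 0 <= b by rewrite /b; apply: divr_ge0; apply: mulr_ge0 => //; exact: ltW.
  apply: (@le_trans _ _ (\int[P]_w (a * `|A w| ^+ 3 + b * `|Y w| ^+ 3))).
    apply: le_Rintegral => //; first by apply: integD; exact: integZ.
    move=> w _; rewrite -[Y w ^+ 2]real_normK ?num_real//.
    have := @young3 _ (`|A w| / u) (`|Y w| / v).
    rewrite !divr_ge0 ?(ltW u0) ?(ltW v0)// => /(_ isT isT).
    rewrite -(ler_pM2l (mulr_gt0 u0 (exprn_gt0 2 v0))) => H.
    have -> : `|A w| * `|Y w| ^+ 2 = u * v ^+ 2 * (`|A w| / u * (`|Y w| / v) ^+ 2).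
      by field; rewrite !gt_eqF.
    rewrite (le_trans H)// le_eqVlt; apply/orP; left; apply/eqP; rewrite /a /b.
    by field; rewrite !gt_eqF.
  rewrite RintegralD//; [|exact: integZ|exact: integZ].
  rewrite !RintegralZl//.
  apply: (@le_trans _ _ (a * u ^+ 3 + b * v ^+ 3)).
    by apply: lerD; apply: ler_wpM2l.
  rewrite le_eqVlt; apply/orP; left; apply/eqP; rewrite /a /b.
  by field; rewrite !gt_eqF.
move=> x0 y0 LA LY; apply/ler_addgt0Pr => e e0.
(* The normalisation needs positive bounds, so x and y are raised by a small t. For t at most 1 this
   raises x y^2 by at most t C. *)
pose C := (y + 1) ^+ 2 + x * (2 * y + 1).
have C0 : 0 < C.
  by apply: ltr_pwDl; [apply: exprn_gt0; lra|apply: mulr_ge0 => //; lra].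
pose t := Num.min 1 (e / C).
have t0 : 0 < t by rewrite /t lt_min ltr01 divr_gt0.
have t1 : t <= 1 by rewrite /t ge_min lexx.
have tC : t * C <= e by rewrite -ler_pdivlMr// /t ge_min lexx orbT.
apply: (le_trans (pos (x + t) (y + t) _ _ _ _)).
- by rewrite ltr_wpDl.
- by rewrite ltr_wpDl.
- by apply: L3_le LA => //; rewrite lerDl ltW.
- by apply: L3_le LY => //; rewrite lerDl ltW.
apply: (@le_trans _ _ (x * y ^+ 2 + t * C)); last by rewrite lerD2l.
have -> : (x + t) * (y + t) ^+ 2 = x * y ^+ 2 + t * ((y + t) ^+ 2 + x * (2 * y + t)) by ring.
rewrite lerD2l ler_pM2l// /C lerD//.
  by rewrite lerXn2r ?nnegrE ?lerD2l// addr_ge0// ltW.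
by rewrite ler_wpM2l// lerD2l.
Qed.

Lemma measurable_cube f : measurable_fun setT f ->
  measurable_fun setT (fun w => `|f w| ^+ 3).
Proof. by move=> mf; apply: measurable_funX; exact: measurable_norm. Qed.

Lemma integ_first_order A Y x y : L3 A x -> L3 Y y ->
  integ (fun w => `|A w| * A w * Y w).
Proof.
move=> LA LY; apply: integ_le (integ_mul_sqr LY LA) _.
  case: LA => mA _ _; case: LY => mY _ _.
  apply: measurable_funM => //; apply: measurable_funM => //.
  exact: measurable_norm.
by move=> w; rewrite !normrM normr_id -[A w ^+ 2]real_normK ?num_real// mulrC.
Qed.

(** The first-order mean is left unevaluated because it is treated in two ways: estimated by Hoelder
    it yields the triangle inequality [L3D], and when it vanishes it yields the sharper
    [L3D_orth]. *)
Lemma L3D_expansion A Y x y : 0 <= x -> 0 <= y -> L3 A x -> L3 Y y ->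
  integ (fun w => `|A w + Y w| ^+ 3) /\
  \int[P]_w (`|A w + Y w| ^+ 3) <=
    x ^+ 3 + 3 * \int[P]_w (`|A w| * A w * Y w) + 3 * (x * y ^+ 2) + y ^+ 3.
Proof.
move=> x0 y0 LA LY.
have i1 := integ_first_order LA LY; have i2 := integ_mul_sqr LA LY.
have h2 := L3_hoelder x0 y0 LA LY.
have [mA iA Ax] := LA; have [mY iY Yy] := LY.
have i12 := integD iA (integZ 3 i1).
have i123 := integD i12 (integZ 3 i2).
have i4 := integD i123 iY.
have iAY : integ (fun w => `|A w + Y w| ^+ 3).
  apply: integ_le i4 _; first by apply: measurable_cube; exact: measurable_funD.
  by move=> w; rewrite ger0_norm ?exprn_ge0//; exact: normr_cube_add.
split => //.
apply: le_trans (le_Rintegral measurableT iAY i4 (fun w _ => normr_cube_add (A w) (Y w))) _.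
rewrite RintegralD// RintegralD//; last exact: integZ.
rewrite RintegralD//; last exact: integZ.
rewrite (RintegralZl _ measurableT i1) (RintegralZl _ measurableT i2).
by apply: lerD => //; apply: lerD; [exact: lerD|rewrite ler_pM2l].
Qed.

Lemma L3D A Y x y : 0 <= x -> 0 <= y -> L3 A x -> L3 Y y ->
  L3 (fun w => A w + Y w) (x + y).
Proof.
move=> x0 y0 LA LY; have [iAY h] := L3D_expansion x0 y0 LA LY.
have [mA _ _] := LA; have [mY _ _] := LY.
split => //; first exact: measurable_funD.
apply: le_trans h _.
have h1 := L3_hoelder y0 x0 LY LA.
have : \int[P]_w (`|A w| * A w * Y w) <= y * x ^+ 2.
  apply: le_trans h1; apply: le_Rintegral => //.
  - exact: integ_first_order LA LY.
  - exact: integ_mul_sqr LY LA.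
  move=> w _; rewrite (le_trans (ler_norm _))// !normrM normr_id.
  by rewrite -[A w ^+ 2]real_normK ?num_real// mulrC.
lra.
Qed.

Lemma L3D_orth A Y x y z : 0 <= x -> 0 <= y -> 0 <= z -> L3 A x -> L3 Y y ->
  \int[P]_w (`|A w| * A w * Y w) = 0 ->
  z ^+ 2 = x ^+ 2 + 9 / 4 * y ^+ 2 -> L3 (fun w => A w + Y w) z.
Proof.
move=> x0 y0 z0 LA LY AY0 zE; have [iAY] := L3D_expansion x0 y0 LA LY.
have [mA _ _] := LA; have [mY _ _] := LY.
rewrite AY0 mulr0 addr0 => h.
split => //; first exact: measurable_funD.
by apply: le_trans h _; exact: sqrt_cube_bound.
Qed.

Lemma L3_sum (I : Type) (s : seq I) (Y : I -> T -> R) (y : I -> R) :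
  (forall i, 0 <= y i) -> (forall i, L3 (Y i) (y i)) ->
  L3 (fun w => \sum_(i <- s) Y i w) (\sum_(i <- s) y i).
Proof.
move=> y0 LY; elim: s => [|i s IH].
  rewrite (_ : (fun _ => _) = fun=> 0); last by apply/funext => w; rewrite big_nil.
  rewrite big_nil; split => //.
    by rewrite normr0 expr0n; exact: integ_cst.
  by rewrite normr0 expr0n Rintegral_cst// mul0r.
rewrite (_ : (fun _ => _) = fun w => Y i w + \sum_(j <- s) Y j w).
  by rewrite big_cons; apply: L3D => //; exact: sumr_ge0.
by apply/funext => w; rewrite big_cons.
Qed.

Lemma L3_indepM U V x y : indep_pair P U V -> L3 U x -> L3 V y ->
  0 <= x -> 0 <= y -> L3 (fun w => U w * V w) (x * y).
Proof.
move=> UV [mU iU Ux] [mV iV Vy] x0 y0.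
have mc : measurable_fun [set: R] (fun t : R => `|t| ^+ 3).
  by apply: measurable_funX; exact: normr_measurable.
have iUV := indep_pair_comp mc mc UV.
have E : (fun w => `|U w * V w| ^+ 3) = (fun w => `|U w| ^+ 3 * `|V w| ^+ 3).
  by apply/funext => w; rewrite normrM exprMn.
split; first exact: measurable_funM.
  by rewrite E; exact: (indep_integrableM iU iV iUV).
rewrite E -lee_fin -mean_EFin; last exact: (indep_integrableM iU iV iUV).
rewrite (indep_integralM iU iV iUV) [X in (X * _)%E]mean_EFin// [X in (_ * X)%E]mean_EFin//.
rewrite -EFinM lee_fin exprMn ler_pM//; apply: Rintegral_ge0 => w _ /=; exact: exprn_ge0.
Qed.

Lemma L3_integ f x : L3 f x -> integ f.
Proof.
move=> [mf i_f _]; apply: (integ_le mf (integD (integ_cst 1) i_f)) => w.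
have [h|h] := leP `|f w| 1; first by rewrite (le_trans h)// lerDl exprn_ge0.
apply: (@le_trans _ _ (`|f w| ^+ 3)); last by rewrite lerDr.
by rewrite -[leLHS]expr1 ler_weXn2l// ltW.
Qed.

Lemma L3_integM f g x y : L3 f x -> L3 g y -> integ (fun w => f w * g w).
Proof.
move=> Lf Lg; have [mf _ _] := Lf; have [mg _ _] := Lg.
(* With the constant 1 as the first factor, [integ_mul_sqr] gives integrability of squares. *)
have L1 : L3 (fun=> 1) 1.
  split => //; first exact: integ_cst.
  rewrite Rintegral_cst// normr1 !expr1n mul1r.
    by rewrite (congr1 fine (probability_setT P) : fine (P [set: T]) = 1).
apply: (integ_le (measurable_funM mf mg) (integD (integ_mul_sqr L1 Lf) (integ_mul_sqr L1 Lg))) => w.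
rewrite normr1 !mul1r normrM -[f w ^+ 2]real_normK ?num_real// -[g w ^+ 2]real_normK ?num_real//.
have := sqr_ge0 (`|f w| - `|g w|); have := sqr_ge0 (`|f w| + `|g w|); lra.
Qed.

End third_moments.

(** * Multilinear polynomials indexed by multi-indices *)

Section multi_index_polynomials.
Context {R : realType} {m : nat}.
Implicit Types (p : seq (R * mindex m)) (a b : mindex m) (x : nat -> 'I_m -> R) (n : nat).

Definition drop_index n a : mindex m := [seq q <- a | q.1 != n].

Lemma is_mindexE a : is_mindex a = sorted (relpre fst ltn) a.
Proof. by rewrite /is_mindex sorted_map. Qed.

Lemma is_mindex_uniq a : is_mindex a -> uniq (map fst a).
Proof. by apply: sorted_uniq; [exact: ltn_trans|exact: ltnn]. Qed.

Lemma is_mindex_drop n a : is_mindex a -> is_mindex (drop_index n a).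
Proof.
rewrite !is_mindexE; apply: sorted_filter.
by move=> y x z /= ; exact: ltn_trans.
Qed.

(** First components are strictly increasing, so no other entry carries [n] and the filter removes
    exactly one entry. *)
Lemma perm_drop_index n i a : is_mindex a -> (n, i) \in a ->
  perm_eq a ((n, i) :: drop_index n a).
Proof.
move=> /is_mindex_uniq ua nia.
have uqa : uniq a := map_uniq ua.
apply: uniq_perm => //=.
  by rewrite filter_uniq// andbT mem_filter /= eqxx.
move=> q; rewrite inE mem_filter.
have [->|] := eqVneq q (n, i); first by rewrite nia.
case: q => k j /=; have [->|//] := eqVneq k n => qi.
apply/negP => nja; move: qi; apply/negP; rewrite negbK.
suff -> : (n, j) = (n, i) by [].
move: nja nia ua; elim: a {uqa} => // q a IH; rewrite !inE /=.
move=> /orP[/eqP<-|nja] /orP[/eqP<-|nia] //= /andP[qa ua].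
- by move/negP: qa; case; apply/mapP; exists (n, i).
- by move/negP: qa; case; apply/mapP; exists (n, j).
- exact: IH.
Qed.

Lemma mem_index_uniq n i j a : is_mindex a -> (n, i) \in a ->
  ((n, j) \in a) = (j == i).
Proof.
move=> ia nia; rewrite (perm_mem (perm_drop_index ia nia)) inE mem_filter /= eqxx orbF.
by rewrite xpair_eqE eqxx.
Qed.

Lemma sum_index (V : zmodType) (F : 'I_m -> V) n i a : is_mindex a -> (n, i) \in a ->
  \sum_(j | (n, j) \in a) F j = F i.
Proof.
by move=> ia nia; rewrite (eq_bigl (pred1 i)) ?big_pred1_eq// => j; exact: mem_index_uniq.
Qed.

Lemma sum_index0 (V : zmodType) (F : 'I_m -> V) n a : n \notin map fst a ->
  \sum_(j | (n, j) \in a) F j = 0.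
Proof.
move=> na; rewrite big_pred0// => j; apply/negP => nja; move/negP: na; apply.
by apply/mapP; exists (n, j).
Qed.

(** Both lists are rearrangements of the same entries, and a strictly sorted list is determined by
    its entries. This keeps the multi-indices of [partial_deriv] distinct. *)
Lemma drop_index_inj n i a b : is_mindex a -> is_mindex b ->
  (n, i) \in a -> (n, i) \in b -> drop_index n a = drop_index n b -> a = b.
Proof.
move=> ia ib nia nib ab.
have pab : perm_eq a b.
  rewrite (perm_trans (perm_drop_index ia nia))// ab perm_sym.
  exact: perm_drop_index.
move: ia ib; rewrite !is_mindexE => sa sb.
apply: (@irr_sorted_eq _ (relpre fst ltn)) => //.
- by move=> y x z /=; exact: ltn_trans.
- by move=> x /=; exact: ltnn.
- exact: perm_mem.
Qed.

Lemma xpow_drop x n i a : is_mindex a -> (n, i) \in a ->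
  xpow x a = x n i * xpow x (drop_index n a).
Proof.
by move=> ia nia; rewrite /xpow (perm_big _ (perm_drop_index ia nia))/= big_cons.
Qed.

Lemma size_drop n i a : is_mindex a -> (n, i) \in a -> size a = (size (drop_index n a)).+1.
Proof. by move=> ia nia; rewrite (perm_size (perm_drop_index ia nia)). Qed.

Definition evalp x p : R := \sum_(t <- p) t.1 * xpow x t.2.

(** A squared l^2 norm of the coefficients that charges a factor [K] per variable, so that
    [weight_split] reproduces the recursion z^2 = x^2 + (9/4) y^2 of [L3D_orth]. *)
Definition weight (K : R) p : R := \sum_(t <- p) K ^+ size t.2 * t.1 ^+ 2.

(** Distinctness matters: coefficients of a repeated multi-index would add up before being squared,
    and [weight] would no longer control the polynomial. *)
Definition well_formed p : bool := all (@is_mindex m) (map snd p) && uniq (map snd p).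

Definition in_supp (S : pred nat) p : bool :=
  all (fun t => all (fun q => S q.1) t.2) p.

Definition freeof n p := [seq t <- p | n \notin map fst t.2].

Definition partial_deriv n i p := [seq (t.1, drop_index n t.2) | t <- p & (n, i) \in t.2].

Lemma well_formed_mem p t : well_formed p -> t \in p -> is_mindex t.2.
Proof. by move=> /andP[/allP H _] tp; apply: H; apply/mapP; exists t. Qed.

Lemma well_formed_free n p : well_formed p -> well_formed (freeof n p).
Proof.
move=> /andP[ap up]; apply/andP; split.
  rewrite all_map all_filter; move: ap; rewrite all_map.
  by apply: sub_all => t /= ->; rewrite implybT.
by apply: subseq_uniq up; apply: map_subseq; exact: filter_subseq.
Qed.

Lemma well_formed_partial_deriv n i p : well_formed p -> well_formed (partial_deriv n i p).
Proof.
move=> gp; have /andP[ap up] := gp; apply/andP; split.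
  rewrite -map_comp all_map; apply/allP => t; rewrite mem_filter => /andP[_ tp] /=.
  by apply: is_mindex_drop; exact: well_formed_mem tp.
rewrite -map_comp.
rewrite (_ : map _ _ = map (drop_index n) (map snd [seq t <- p | (n, i) \in t.2])); last first.
  by rewrite -map_comp.
rewrite map_inj_in_uniq.
  by apply: subseq_uniq up; apply: map_subseq; exact: filter_subseq.
move=> a b /mapP[t + ->] /mapP[u + ->]; rewrite !mem_filter => /andP[nit tp] /andP[niu uq].
by apply: drop_index_inj nit niu; [exact: well_formed_mem tp|exact: well_formed_mem uq].
Qed.

(* Both evaluation and weight are sums over the terms, split here according to
   whether the index n occurs and, if so, with which component. *)
Lemma split_terms (F : R * mindex m -> R) (H : 'I_m -> R * mindex m -> R) n p :
  well_formed p ->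
  (forall t i, t \in p -> (n, i) \in t.2 -> F t = H i (t.1, drop_index n t.2)) ->
  \sum_(t <- p) F t = \sum_(t <- freeof n p) F t + \sum_i \sum_(t <- partial_deriv n i p) H i t.
Proof.
move=> gp FH.
under [X in _ + X]eq_bigr => i _ do rewrite big_map big_filter big_mkcond.
rewrite exchange_big /=.
have -> : \sum_(t <- freeof n p) F t = \sum_(t <- p) (if n \notin map fst t.2 then F t else 0).
  by rewrite big_filter big_mkcond.
rewrite -big_split /=.
rewrite big_seq [RHS]big_seq; apply: eq_bigr => t tp.
rewrite -big_mkcond /=; have it := well_formed_mem gp tp.
have [/mapP[[k i] kit /= nk]|nt] := boolP (n \in map fst t.2); last first.
  by rewrite sum_index0// addr0.
move: kit; rewrite -nk => kit.
by rewrite (sum_index _ it kit) add0r; exact: FH.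
Qed.

Lemma evalp_split x n p : well_formed p ->
  evalp x p = evalp x (freeof n p) + \sum_i x n i * evalp x (partial_deriv n i p).
Proof.
move=> gp; rewrite /evalp.
under [X in _ + X]eq_bigr => i _ do rewrite big_distrr.
apply: (split_terms (H := fun i t => x n i * (t.1 * xpow x t.2))) => // t i tp nit.
by rewrite (xpow_drop x (well_formed_mem gp tp) nit) mulrCA.
Qed.

Lemma weight_split K n p : well_formed p ->
  weight K p = weight K (freeof n p) + K * \sum_i weight K (partial_deriv n i p).
Proof.
move=> gp; rewrite /weight big_distrr /=.
under [X in _ + X]eq_bigr => i _ do rewrite big_distrr.
apply: (split_terms (H := fun i t => K * (K ^+ size t.2 * t.1 ^+ 2))) => // t i tp nit.
by rewrite (size_drop (well_formed_mem gp tp) nit) exprS mulrA.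
Qed.

Lemma weight_ge0 K p : 0 <= K -> 0 <= weight K p.
Proof. by move=> K0; apply: sumr_ge0 => t _; apply: mulr_ge0; [exact: exprn_ge0|exact: sqr_ge0]. Qed.

Lemma in_supp_free (S S' : pred nat) n p : (forall k, S k -> k != n -> S' k) ->
  in_supp S p -> in_supp S' (freeof n p).
Proof.
move=> SS' /allP Sp; apply/allP => t; rewrite mem_filter => /andP[nt tp].
apply/allP => q qt; apply: SS'; first exact: (allP (Sp _ tp)).
by apply: contraNneq nt => <-; apply/mapP; exists q.
Qed.

Lemma in_supp_partial_deriv (S S' : pred nat) n i p : (forall k, S k -> k != n -> S' k) ->
  in_supp S p -> in_supp S' (partial_deriv n i p).
Proof.
move=> SS' /allP Sp; apply/allP => _ /mapP[t + ->]; rewrite mem_filter => /andP[nt tp].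
apply/allP => q; rewrite mem_filter => /andP[qn qt]; apply: SS' => //.
exact: (allP (Sp _ tp)).
Qed.

Lemma in_suppT p : in_supp predT p.
Proof. by apply/allP => t _; apply/allP. Qed.

Lemma evalp_ext (S : pred nat) x y p : in_supp S p -> (forall n, S n -> x n = y n) ->
  evalp x p = evalp y p.
Proof.
move=> /allP Sp xy; rewrite /evalp big_seq [RHS]big_seq; apply: eq_bigr => t tp.
congr (_ * _); rewrite /xpow big_seq [RHS]big_seq; apply: eq_bigr => q qt.
by rewrite xy//; exact: (allP (Sp _ tp)).
Qed.

(** Cauchy-Schwarz in Lagrange's form: the defect is half the double sum of (z_i - z_j)^2. *)
Lemma sqr_sum_le (z : 'I_m -> R) : (\sum_i z i) ^+ 2 <= m%:R * \sum_i z i ^+ 2.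
Proof.
have : 0 <= \sum_i \sum_j (z i - z j) ^+ 2.
  by apply: sumr_ge0 => i _; apply: sumr_ge0 => j _; exact: sqr_ge0.
have -> : \sum_i \sum_j (z i - z j) ^+ 2 =
    2 * (m%:R * \sum_i z i ^+ 2 - (\sum_i z i) ^+ 2).
  have inner (i : 'I_m) : \sum_j (z i - z j) ^+ 2 =
      m%:R * z i ^+ 2 + (- 2 * \sum_j z j) * z i + \sum_j z j ^+ 2.
    rewrite (eq_bigr (fun j => z i ^+ 2 + (- 2 * z i) * z j + z j ^+ 2)); last first.
      by move=> j _; ring.
    by rewrite !big_split /= sumr_const card_ord -mulr_sumr -mulr_natl; ring.
  under eq_bigr => i _ do rewrite inner.
  by rewrite !big_split /= sumr_const card_ord -!mulr_sumr -mulr_natl; ring.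
by rewrite pmulr_rge0// subr_ge0.
Qed.

End multi_index_polynomials.

(** * Hypercontractivity in L^3 *)

Section hypercontractivity.
Context {R : realType} {d : measure_display} {T : measurableType d}.
Variables (P : probability T R) (m : nat) (X : nat -> 'I_m -> T -> R) (M : R).
Hypotheses (mX : forall n i, measurable_fun setT (X n i)) (iX : indep_vectors P X).
Hypotheses (X0 : forall n i, \int[P]_w X n i w = 0) (M0 : 0 <= M).
Hypothesis X3 : forall n i, L3 P (X n i) M.

Definition polyrv (p : seq (R * mindex m)) (w : T) : R := evalp (fun n i => X n i w) p.

Lemma polyrv_split n p : well_formed p ->
  polyrv p = fun w => polyrv (freeof n p) w + \sum_i X n i w * polyrv (partial_deriv n i p) w.
Proof. by move=> gp; apply/funext => w; exact: evalp_split. Qed.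

Lemma polyrv_obs S p : in_supp S p -> measurable_fun setT (polyrv p : obs X S -> R).
Proof.
move=> /allP Sp; rewrite /polyrv /evalp.
rewrite (_ : (fun w => _) =
  fun w : obs X S => \sum_(t <- p) (if t \in p then t.1 * xpow (fun n i => X n i w) t.2 else 0)); last first.
  by apply/funext => w; rewrite big_seq [RHS]big_seq; apply: eq_bigr => t ->.
apply: measurable_sum => t; have [tp|//] := boolP (t \in p).
apply: measurable_funM => //; rewrite /xpow.
rewrite (_ : (fun w => _) =
  fun w : obs X S => \prod_(q <- t.2) (if q \in t.2 then X q.1 q.2 w else 0)); last first.
  by apply/funext => w; rewrite big_seq [RHS]big_seq; apply: eq_bigr => q ->.
apply: measurable_prod => q qt; rewrite qt.
by apply: obs_coord; exact: (allP (Sp _ tp)).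
Qed.

Lemma coord_obs n i : measurable_fun setT (X n i : obs X (pred1 n) -> R).
Proof. by apply: obs_coord; exact: eqxx. Qed.

Lemma coord_indep n (U V : T -> R) :
  measurable_fun setT (U : obs X (pred1 n) -> R) ->
  measurable_fun setT (V : obs X (predC1 n) -> R) -> indep_pair P U V.
Proof. by apply: obs_indep_pair => // k /= /eqP ->; rewrite eqxx. Qed.

Lemma free_supp S n (p : seq (R * mindex m)) : in_supp S p -> in_supp (predC1 n) (freeof n p).
Proof. exact: in_supp_free. Qed.

Lemma partial_deriv_supp S n i (p : seq (R * mindex m)) : in_supp S p -> in_supp (predC1 n) (partial_deriv n i p).
Proof. exact: in_supp_partial_deriv. Qed.

(** The price of one variable: 9/4 from [sqrt_cube_bound], m from [sqr_sum_le], and M^2 from the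
    bound on the coordinates. *)
Let K := 9 / 4 * m%:R * M ^+ 2.

Let K0 : 0 <= K.
Proof. by rewrite /K; apply: mulr_ge0; [rewrite mulr_ge0//; lra|exact: sqr_ge0]. Qed.

(** Each product is bounded by independence, the sum over [i] by the triangle inequality and
    Cauchy-Schwarz. The bound [M'] for the n-th vector is kept apart from [M], so that in the
    exchange each of the two vectors is charged with its own moment. *)
Lemma L3_linear_form n (V : 'I_m -> T -> R) (v : 'I_m -> R) M' :
  0 <= M' -> (forall i, L3 P (X n i) M') ->
  (forall i, measurable_fun setT (V i : obs X (predC1 n) -> R)) ->
  (forall i, 0 <= v i) -> (forall i, L3 P (V i) (v i)) ->
  L3 P (fun w => \sum_i X n i w * V i w) (Num.sqrt (m%:R * M' ^+ 2 * \sum_i v i ^+ 2)).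
Proof.
move=> M'0 LX mV v0 LV.
apply: (@L3_le _ _ _ _ _ (\sum_i M' * v i)).
- by apply: sumr_ge0 => i _; exact: mulr_ge0.
- rewrite -mulr_sumr -(@ler_sqr _ (_ * _)) ?nnegrE ?sqrtr_ge0//; last first.
    by apply: mulr_ge0 => //; exact: sumr_ge0.
  have s0 : 0 <= \sum_i v i ^+ 2 by apply: sumr_ge0 => i _; exact: sqr_ge0.
  rewrite sqr_sqrtr; last by apply: mulr_ge0 => //; apply: mulr_ge0 => //; exact: sqr_ge0.
  rewrite exprMn (mulrC m%:R) -[leRHS]mulrA; apply: ler_wpM2l; first exact: sqr_ge0.
  exact: sqr_sum_le.
- apply: L3_sum => i; first exact: mulr_ge0.
  by apply: L3_indepM => //; apply: (@coord_indep n) => //; exact: coord_obs.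
Qed.

Lemma mean_linear_form n (V : 'I_m -> T -> R) :
  (forall i, measurable_fun setT (V i : obs X (predC1 n) -> R)) ->
  (forall i, integ P (V i)) ->
  \int[P]_w (\sum_i X n i w * V i w) = 0.
Proof.
move=> mV iV.
have iXn i := L3_integ (X3 n i).
have ind i : indep_pair P (X n i) (V i).
  by apply: (@coord_indep n) => //; exact: coord_obs.
rewrite mean_sum; last by move=> i; exact: indep_integrableM (iXn i) (iV i) (ind i).
rewrite big1// => i _.
apply: EFin_inj; rewrite -mean_EFin; last exact: indep_integrableM (iXn i) (iV i) (ind i).
by rewrite (indep_integralM (iXn i) (iV i) (ind i)) mean_EFin// X0 mul0e.
Qed.

Theorem hypercontractivity p (l : seq nat) : well_formed p -> in_supp (mem l) p ->
  L3 P (polyrv p) (Num.sqrt (weight K p)).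
Proof.
elim: l p => [|n l IH] p gp Sp.
  have c1 (c : R) : Num.sqrt (c ^+ 2) = `|c| by rewrite sqrtr_sqr.
  have nil_t t : t \in p -> t.2 = [::].
    move=> tp; have := allP Sp _ tp; by case: t.2.
  (* Without indices every term is constant, and distinctness allows at most one such term. *)
  have [c [Qc wc]] : exists c, polyrv p = (fun=> c) /\ weight K p = c ^+ 2.
    case: p gp Sp nil_t => [|[c a] [|[c' a'] p]] gp Sp nil_t.
    - exists 0; split; first by apply/funext => w; rewrite /polyrv /evalp big_nil.
      by rewrite /weight big_nil expr0n.
    - have /= a0 := nil_t (c, a) (mem_head _ _); exists c; split.
        by apply/funext => w; rewrite /polyrv /evalp big_seq1 a0 /xpow big_nil mulr1.
      by rewrite /weight big_seq1 a0 expr0 mul1r.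
    - have /= a0 := nil_t (c, a) (mem_head _ _).
      have /= a'0 : a' = [::].
        by apply: (nil_t (c', a')); rewrite inE mem_head orbT.
      by move: gp; rewrite /well_formed /= a0 a'0 mem_head /= !andbF.
  rewrite Qc wc c1; split => //; first exact: integ_cst.
  by rewrite Rintegral_cst// (congr1 fine (probability_setT P) : fine (P [set: T]) = 1) mulr1.
have Sl k : mem (n :: l) k -> k != n -> mem l k.
  by rewrite /= inE => /orP[/eqP->|//]; rewrite eqxx.
have gf := well_formed_free n gp.
have LA := IH _ gf (in_supp_free Sl Sp).
have LB i := IH _ (well_formed_partial_deriv n i gp) (in_supp_partial_deriv i Sl Sp).
have mA := polyrv_obs (free_supp n Sp).
have mB i := polyrv_obs (partial_deriv_supp n i Sp).
have w0 q := weight_ge0 q K0.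
rewrite (polyrv_split n gp).
have LY := L3_linear_form M0 (X3 n) mB (fun i => sqrtr_ge0 _) LB.
apply: (L3D_orth _ _ _ LA LY); rewrite ?sqrtr_ge0//.
(* |A| A Y is again linear in the n-th vector, with coefficients [V i] that depend on the other
   vectors only; hence its mean is zero. *)
- pose V i w := `|polyrv (freeof n p) w| * polyrv (freeof n p) w * polyrv (partial_deriv n i p) w.
  rewrite (_ : (fun w => _) = fun w => \sum_i X n i w * V i w); last first.
    apply/funext => w; rewrite mulr_sumr; apply: eq_bigr => i _.
    by rewrite /V mulrCA.
  apply: mean_linear_form => i; last exact: integ_first_order LA (LB i).
  apply: measurable_funM => //; apply: measurable_funM => //.
  exact: (measurableT_comp (@normr_measurable R setT)).
- rewrite !sqr_sqrtr//; last first.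
    apply: mulr_ge0; last by apply: sumr_ge0 => i _; exact: sqr_ge0.
    by apply: mulr_ge0 => //; exact: sqr_ge0.
  rewrite (weight_split K n gp) /K; congr (_ + _).
  under [in RHS]eq_bigr => i _ do rewrite sqr_sqrtr//.
  by rewrite !mulrA.
Qed.

End hypercontractivity.

(** * From the L^3 norm to third moments *)

Section cube_norm.
Context {R : realType} {d : measure_display} {T : measurableType d}.
Variable P : probability T R.

Lemma Lnorm3_cube (f : T -> R) :
  ((Lnorm P 3%:E (EFin \o f)) `^ 3 = \int[P]_w (`|f w| ^+ 3)%:E)%E.
Proof.
rewrite poweR_Lnorm//; apply: eq_integral => w _ /=.
by rewrite powR_mulrn.
Qed.

Lemma le_Lnorm3 (f : T -> R) (x : R) : 0 <= x ->
  measurable_fun setT f -> (Lnorm P 3%:E (EFin \o f) <= x%:E)%E -> L3 P f x.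
Proof.
move=> x0 mf fx.
have fx3 : (\int[P]_w (`|f w| ^+ 3)%:E <= (x ^+ 3)%:E)%E.
  rewrite -Lnorm3_cube -powR_mulrn// -poweR_EFin.
  by apply: gt0_ler_poweR => //; rewrite in_itv/= leey andbT// Lnorm_ge0.
have i_f : integ P (fun w => `|f w| ^+ 3).
  apply/integrableP; split; first exact/measurable_EFinP/measurable_cube.
  rewrite (le_lt_trans _ (ltry (x ^+ 3)))//.
  by under eq_integral => w _ do rewrite /= ger0_norm ?exprn_ge0//.
by split => //; rewrite -lee_fin -mean_EFin.
Qed.

End cube_norm.

(** * A stopped martingale to test Burkholder's inequality *)

Section stopped_martingale.
Variable R : realType.

(* The process starts at 1 and is multiplied by 7/5 as long as a fair coin shows
   heads; at the first tail, at time j, it falls from (7/5)^j to (3/5)(7/5)^j and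
   stops.  Outcomes are the possible values of j, with all j >= n merged into n. *)
Definition jump (k j : nat) : R :=
  if (j < k)%N then 0 else (if j == k then -1 else 1) * (2 / 5 * (7 / 5) ^+ k).

Variable n : nat.

Definition mass (j : nat) : R := 2^-1 ^+ (if (j < n)%N then j.+1 else n).

Lemma mass_ge0 j : 0 <= mass j.
Proof. by rewrite /mass exprn_ge0// invr_ge0. Qed.

Lemma sum_massE (g : nat -> R) : \sum_(j < n.+1) mass j * g j =
  \sum_(j < n) 2^-1 ^+ j.+1 * g j + 2^-1 ^+ n * g n.
Proof.
rewrite big_ord_recr /= {2}/mass ltnn; congr (_ + _).
by apply: eq_bigr => j _; rewrite /mass ltn_ord.
Qed.

Lemma sum_mass : \sum_(j < n.+1) mass j = 1.
Proof.
under eq_bigr => j _ do rewrite -(mulr1 (mass j)).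
rewrite (sum_massE (fun=> 1)) mulr1; elim: n => [|k IH].
  by rewrite big_ord0 expr0 add0r.
rewrite big_ord_recr /= -[RHS]IH mulr1 exprS -addrA; congr (_ + _).
by field.
Qed.

(** Finitely many point masses on the discrete space [nat]: every function is measurable and
    integrable, and means are finite sums. *)
Definition stop_law := msum (fun j => mscale (NngNum (mass_ge0 j)) (@dirac _ nat j R)) n.+1.

HB.instance Definition _ := Measure.on stop_law.

Lemma ge0_integral_stop_law (g : nat -> \bar R) : (forall j, (0 <= g j)%E) ->
  (\int[stop_law]_j g j = \sum_(j < n.+1) (mass j)%:E * g j)%E.
Proof.
move=> g0; rewrite /stop_law ge0_integral_measure_sum//.
apply: eq_bigr => j _; rewrite ge0_integral_mscale// integral_dirac//.
by rewrite diracT mul1e.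
Qed.

Let stop_lawT : stop_law setT = 1%E.
Proof.
rewrite -[LHS]mul1e -(integral_cst stop_law measurableT) ge0_integral_stop_law//.
by under eq_bigr do rewrite mule1; rewrite sumEFin sum_mass.
Qed.

HB.instance Definition _ := Measure_isProbability.Build _ _ R stop_law stop_lawT.

Lemma integ_stop_law (g : nat -> R) : integ (stop_law : probability _ _) g.
Proof.
apply/integrableP; split => //.
rewrite ge0_integral_stop_law//.
by under eq_bigr => j _ do rewrite -EFinM; rewrite sumEFin ltry.
Qed.

Lemma mean_stop_law (g : nat -> R) :
  \int[stop_law]_j g j = \sum_(j < n.+1) mass j * g j.
Proof.
have ge0 (h : nat -> R) : (forall j, 0 <= h j) ->
    \int[stop_law]_j h j = \sum_(j < n.+1) mass j * h j.
  move=> h0; rewrite /Rintegral ge0_integral_stop_law//.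
  by under eq_bigr => j _ do rewrite -EFinM; rewrite sumEFin.
have abs0 (x : R) : 0 <= `|x| + x by rewrite -lerBlDr sub0r -normrN ler_norm.
have -> : \int[stop_law]_j g j =
    \int[stop_law]_j (`|g j| + g j) - \int[stop_law]_j `|g j|.
  rewrite -RintegralB//; [|exact: integ_stop_law|exact: integ_stop_law].
  by apply: eq_Rintegral => j _; rewrite addrC addKr.
rewrite !ge0// -sumrB; apply: eq_bigr => j _.
by rewrite -mulrBr addrC addKr.
Qed.

(** The martingale differences. The starting value 1 counts as difference number 0, so [jump k] is
    difference number k+1; after [n] steps nothing moves. *)
Definition stopped (k j : nat) : R :=
  if k is k'.+1 then (if (k' < n)%N then jump k' j else 0) else 1.

(* At time k the outcomes j >= k are not yet distinguished. *)
Definition past (k : nat) : set_system nat :=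
  [set A | forall i j, (k <= i)%N -> (k <= j)%N -> A i <-> A j].

Lemma past_sigma_algebra k : sigma_algebra setT (past k).
Proof.
split.
- by [].
- by move=> A FA i j ki kj; have := FA i j ki kj; rewrite /setD /=; tauto.
- move=> A FA i j ki kj; split => -[q _ Aq]; exists q => //.
    exact/(FA q i j).
  exact/(FA q j i).
Qed.

Lemma past_mono k : past k `<=` past k.+1.
Proof. by move=> A FA i j ki kj; apply: FA; exact: ltnW. Qed.

Lemma stopped_adapted k (B : set R) : past k (stopped k @^-1` B).
Proof.
move=> i j ki kj; rewrite /= /stopped; case: k ki kj => //= k ki kj.
by case: ifP => // _; rewrite /jump !ltnNge (ltnW ki) (ltnW kj) /= !gtn_eqF.
Qed.

(** A tail at time k and the later outcomes taken together have equal mass and opposite jumps.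
    Raising [n] by one merely splits the last outcome into two halves. *)
Lemma sum_mass_jump k : (k < n)%N -> \sum_(j < n.+1) mass j * jump k j = 0.
Proof.
rewrite sum_massE; elim: n => // l IH; rewrite ltnS leq_eqVlt => /orP[/eqP ->|kl].
  rewrite big_ord_recr /= big1 ?add0r; last first.
    by move=> j _; rewrite /jump ltn_ord mulr0.
  by rewrite /jump !ltnn eqxx ltnNge leqnSn /= gtn_eqF//; ring.
rewrite big_ord_recr /= -[RHS](IH kl) -addrA; congr (_ + _).
rewrite /jump !ltnNge !(ltnW kl) (leqW (ltnW kl)) /= !gtn_eqF//; last exact: leqW.
by rewrite exprS; field.
Qed.

(** The jump vanishes on the outcomes below k, and an event of [past k] contains either all or none
    of the others. *)
Lemma stopped_martingale k A : past k A ->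
  (\int[stop_law]_(j in A) (stopped k.+1 j)%:E = 0)%E.
Proof.
move=> FA; rewrite integral_mkcond.
pose g j := (if j \in A then stopped k.+1 j else 0).
have -> : (\int[stop_law]_j ((fun j => (stopped k.+1 j)%:E) \_ A) j = \int[stop_law]_j (g j)%:E)%E.
  by apply: eq_integral => j _; rewrite /g patchE; case: ifP.
rewrite (mean_EFin (integ_stop_law g)) mean_stop_law /g /stopped.
have [kn|kn] := ltnP k n; last first.
  by rewrite big1// => j _; case: ifP; rewrite mulr0.
have [kA|kA] := boolP (k \in A).
- congr EFin; rewrite -[RHS](sum_mass_jump kn); apply: eq_bigr => j _; congr (_ * _).
  case: ifPn => // jA; rewrite /jump; case: ltnP => // kj.
  by case/negP: jA; apply: mem_set; apply/(FA k j _ kj) => //; exact: set_mem.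
- rewrite big1// => j _; case: ifPn; rewrite ?mulr0// => jA.
  rewrite /jump; case: ltnP => [|kj]; first by rewrite mulr0.
  by case/negP: kA; apply: mem_set; apply/(FA k j _ kj) => //; exact: set_mem.
Qed.

Lemma sum_stopped j :
  \sum_(k < n.+1) stopped k j = if (j < n)%N then 3 / 5 * (7 / 5) ^+ j else (7 / 5) ^+ n.
Proof.
rewrite big_ord_recl /=.
under eq_bigr => k _ do rewrite /stopped /= ltn_ord.
elim: n => [|l IH]; first by rewrite big_ord0 addr0 expr0.
rewrite big_ord_recr /= addrA IH /jump.
case: (ltngtP j l) => jl.
- by rewrite ltnS (ltnW jl) addr0.
- by rewrite ltnS leqNgt jl /= exprS; field.
- by rewrite jl ltnSn; field.
Qed.

(** Closed form of the geometric sum 1 + (4/25) (1 + 49/25 + ... + (49/25)^(i-1)), the square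
    function after i jumps. An outcome j < n has made j+1 jumps, the fall included. *)
Definition qvar (i : nat) : R := 5 / 6 + 1 / 6 * (49 / 25) ^+ i.

Lemma sum_sqr_stopped j : \sum_(k < n.+1) stopped k j ^+ 2 =
  qvar (if (j < n)%N then j.+1 else n).
Proof.
rewrite big_ord_recl /= expr1n.
under eq_bigr => k _ do rewrite /stopped /= ltn_ord.
elim: n => [|l IH]; first by rewrite big_ord0 addr0 /qvar expr0; field.
have sqr_step (s : R) : s ^+ 2 = 1 -> (s * (2 / 5 * (7 / 5) ^+ l)) ^+ 2 = 4 / 25 * (49 / 25) ^+ l.
  move=> s1; rewrite exprMn s1 mul1r exprMn exprAC; congr (_ * _); first by field.
  by congr (_ ^+ _); field.
rewrite big_ord_recr /= addrA IH /jump.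
case: (ltngtP j l) => jl.
- by rewrite ltnS (ltnW jl) expr0n addr0.
- by rewrite ltnS leqNgt jl /= sqr_step ?expr1n// /qvar exprS; field.
- by rewrite jl ltnSn sqr_step ?sqrrN ?expr1n// /qvar exprS; field.
Qed.

End stopped_martingale.

(** * Lower bound for Burkholder's constant *)

Section burkholder_constant.
Variable R : realType.

(** Rational upper bounds for the roots of [qvar i], i <= 12, so that the final comparison involves
    rational numbers only. *)
Let rootbound (i : nat) : R := nth 1 [:: 1; 11/10; 5/4; 29/20; 37/20; 12/5; 13/4;
  22/5; 61/10; 17/2; 237/20; 83/5; 116/5] i.

Let sqrt_qvar_le i : (i <= 12)%N -> Num.sqrt (qvar R i) <= rootbound i.
Proof.
move=> i12.
have r0 : 0 <= rootbound i by do 13 (case: i i12 => [|i] i12; first by rewrite /rootbound /=; lra).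
rewrite -(ger0_norm r0) -sqrtr_sqr; apply: ler_wsqrtr; rewrite /qvar.
by do 13 (case: i i12 r0 => [|i] i12 r0; first by rewrite /rootbound /=; lra).
Qed.

(** The right side is the third moment of the final value; the bracket on the left bounds that of
    the root of the square function. As (7/5)^3 / 2 > 1, late outcomes dominate both; the true ratio
    tends to a number slightly above 4 for long runs, and twelve steps already reach 73/20. *)
Let gap : 73 / 20 * (\sum_(j < 12) 2^-1 ^+ j.+1 * (qvar R j.+1 * rootbound j.+1) +
    2^-1 ^+ 12 * (qvar R 12 * rootbound 12)) <=
  \sum_(j < 12) 2^-1 ^+ j.+1 * (3 / 5 * (7 / 5) ^+ j) ^+ 3 + 2^-1 ^+ 12 * ((7 / 5) ^+ 12) ^+ 3.
Proof.
rewrite !big_ord_recr !big_ord0 /= /qvar /rootbound /=.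
lra.
Qed.

Lemma burkholder3_lower_bound (b : R) : 0 <= b -> burkholder3 b -> 73 / 20 <= b ^+ 3.
Proof.
move=> b0 /(_ _ _ (stop_law R 12) past (stopped R 12) 12).
set f := (fun w => \sum_(k < 13) stopped R 12 k w).
set S := (fun w => Num.sqrt (\sum_(k < 13) stopped R 12 k w ^+ 2)).
move=> /(_ past_sigma_algebra) H.
have {}H := H (fun k A _ => I) past_mono (fun k B _ => @stopped_adapted R 12 k B)
  (fun k => @integ_stop_law R 12 (stopped R 12 k)) (@stopped_martingale R 12).
have cube (g : nat -> R) : ((Lnorm (stop_law R 12) 3%:E (EFin \o g)) `^ 3 =
    (\sum_(j < 13) mass R 12 j * `|g j| ^+ 3)%:E)%E.
  by rewrite Lnorm3_cube (mean_EFin (@integ_stop_law R 12 _)) mean_stop_law.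
have le3 : \sum_(j < 13) mass R 12 j * `|f j| ^+ 3 <=
    b ^+ 3 * \sum_(j < 13) mass R 12 j * `|S j| ^+ 3.
  rewrite -lee_fin EFinM -!cube -(powR_mulrn 3 b0) -poweR_EFin.
  rewrite -poweRM ?Lnorm_ge0 ?lee_fin//.
  apply: gt0_ler_poweR => //; rewrite in_itv/= leey andbT ?Lnorm_ge0//.
  by rewrite mule_ge0 ?Lnorm_ge0.
set D := \sum_(j < 12) 2^-1 ^+ j.+1 * (qvar R j.+1 * rootbound j.+1) +
    2^-1 ^+ 12 * (qvar R 12 * rootbound 12).
have q0 i : 0 <= qvar R i by rewrite /qvar addr_ge0 ?mulr_ge0 ?exprn_ge0 ?invr_ge0//; lra.
have cube_le i : (i <= 12)%N -> `|Num.sqrt (qvar R i)| ^+ 3 <= qvar R i * rootbound i.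
  move=> i12; rewrite ger0_norm ?sqrtr_ge0// exprSr sqr_sqrtr//.
  by apply: ler_wpM2l => //; exact: sqrt_qvar_le.
have SD : \sum_(j < 13) mass R 12 j * `|S j| ^+ 3 <= D.
  rewrite (@sum_massE R 12 (fun j => `|S j| ^+ 3)) /D; apply: lerD; last first.
    rewrite /S sum_sqr_stopped ltnn; apply: ler_wpM2l; last exact: cube_le.
    by rewrite exprn_ge0// invr_ge0.
  apply: ler_sum => j _; rewrite /S sum_sqr_stopped ltn_ord.
  by apply: ler_wpM2l; [rewrite exprn_ge0// invr_ge0|exact: cube_le].
have fE : \sum_(j < 13) mass R 12 j * `|f j| ^+ 3 =
    \sum_(j < 12) 2^-1 ^+ j.+1 * (3 / 5 * (7 / 5) ^+ j) ^+ 3 + 2^-1 ^+ 12 * ((7 / 5) ^+ 12) ^+ 3.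
  have p0 i : 0 <= (7 / 5 : R) ^+ i by rewrite exprn_ge0//; lra.
  rewrite (@sum_massE R 12 (fun j => `|f j| ^+ 3)); congr (_ + _).
    apply: eq_bigr => j _; rewrite /f sum_stopped ltn_ord ger0_norm//.
  by rewrite /f sum_stopped ltnn ger0_norm.
have D0 : 0 < D.
  rewrite /D ltr_wpDl//; last by rewrite /qvar /rootbound /=; lra.
  apply: sumr_ge0 => j _; rewrite mulr_ge0 ?exprn_ge0 ?invr_ge0// mulr_ge0//.
  exact: le_trans (sqrtr_ge0 _) (sqrt_qvar_le _).
have b3 : 0 <= b ^+ 3 by exact: exprn_ge0.
rewrite -(ler_pM2r D0); apply: le_trans gap _.
by rewrite -fE (le_trans le3)// ler_wpM2l.
Qed.

End burkholder_constant.

(** * Taylor's formula of third order *)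

Section taylor.
Variable R : realType.
Implicit Types (f : R -> R) (a h t C : R).

(** Integration of the bound without integrals: for s = 1 and s = -1 the function C t^(k+1)/(k+1) -
    s phi(t) vanishes at 0 and has a nonnegative derivative, so the mean value theorem applies. *)
Lemma derivative_growth (phi dphi : R -> R) C (k : nat) :
  (forall t, is_derive t 1 phi (dphi t)) -> phi 0 = 0 ->
  (forall t, 0 <= t -> `|dphi t| <= C * t ^+ k) ->
  forall t, 0 <= t -> `|phi t| <= C / k.+1%:R * t ^+ k.+1.
Proof.
move=> D phi0 dC t t0.
have side (s : R) : `|s| = 1 -> s * phi t <= C / k.+1%:R * t ^+ k.+1.
  move=> s1.
  pose g : R -> R := (C / k.+1%:R) \*: (id ^+ k.+1) - s \*: phi.
  have Dg (u : R) : is_derive u 1 g (C * u ^+ k - s * dphi u).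
    have Du := D u.
    apply: is_derive_eq; rewrite /GRing.scale /= mulr1.
    congr (_ - _); rewrite mulrA; congr (_ * _).
    by rewrite -mulrA mulVf ?mulr1// pnatr_eq0.
  have cg : {within `[0, t], continuous g}.
    apply: continuous_subspaceT => u; apply: differentiable_continuous.
    by apply/derivable1_diffP; have [] := Dg u.
  have [c /[!in_itv]/= /andP[c0 _]] := MVT_segment t0 (fun u _ => Dg u) cg.
  have -> : g t - g 0 = C / k.+1%:R * t ^+ k.+1 - s * phi t.
    have gE u : g u = C / k.+1%:R * u ^+ k.+1 - s * phi u by rewrite /g !fctE.
    by rewrite !gE phi0 expr0n /= !mulr0 !subr0.
  rewrite subr0 -subr_ge0 => ->; apply: mulr_ge0 => //.
  rewrite subr_ge0 (le_trans (ler_norm _))// normrM s1 mul1r.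
  exact: dC.
have [_|_] := ger0P (phi t).
- by have := side 1; rewrite mul1r normr1; apply.
- by have := side (-1); rewrite mulN1r normrN normr1; apply.
Qed.

(** [derivative_growth] is used three times along t -> a + t h; its factors 1, 1/2 and 1/3 produce
    the 1/6. *)
Lemma taylor3 f C : (forall k x, (k < 3)%N -> derivable (derive1n k f) x 1) ->
  (forall x, `|derive1n 3 f x| <= C) -> forall a h,
  `|f (a + h) - f a - derive1n 1 f a * h - derive1n 2 f a * h ^+ 2 / 2| <= C * `|h| ^+ 3 / 6.
Proof.
move=> df fC a h.
have D k (t : R) : (k < 3)%N ->
    is_derive t 1 (fun t => derive1n k f (a + t * h)) (h * derive1n k.+1 f (a + t * h)).
  move=> k3; rewrite derive1nS.
  have Dk : is_derive (a + t * h) 1 (derive1n k f) (derive1 (derive1n k f) (a + t * h)).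
    by rewrite derive1E; apply: derivableP; exact: df.
  have Dl : is_derive t 1 (fun t : R => a + t * h) h.
    rewrite (_ : (fun _ => _) = cst a + h \*: id); last first.
      by apply/funext => u; rewrite !fctE /GRing.scale /= mulrC.
    by apply: is_derive_eq; rewrite /GRing.scale /= mulr1 add0r.
  by rewrite (mulrC h); exact: (@is_derive1_comp R (derive1n k f) (fun t : R => a + t * h) t _ _ Dk Dl).
pose F k t := derive1n k f (a + t * h).
have DB (u : R) (g1 g2 : R -> R) (d1 d2 : R) : is_derive u 1 g1 d1 -> is_derive u 1 g2 d2 ->
    is_derive u 1 (fun t => g1 t - g2 t) (d1 - d2).
  by move=> H1 H2; exact: (is_deriveB H1 H2).
have DF k (u c : R) : (k < 3)%N -> is_derive u 1 (fun t => F k t - c) (h * F k.+1 u).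
  by move=> k3; rewrite -[h * _]subr0; exact: (DB u (F k) (fun=> c) _ _ (D k u k3) (is_derive_cst _ _ _)).
have DX (u c : R) k : is_derive u 1 (fun t => c * t ^+ k) (c * (k%:R * u ^+ k.-1)).
  rewrite (_ : (fun t => _) = c \*: (id ^+ k)); last by apply/funext => v; rewrite !fctE.
  by apply: is_derive_eq; rewrite /GRing.scale /= mulr1.
have E3 t : 0 <= t -> `|F 2 t - F 2 0| <= C * `|h| * t.
  move=> t0; have := @derivative_growth (fun t => F 2 t - F 2 0) (fun t => h * F 3 t) (C * `|h|) 0.
  rewrite divr1; apply => //.
  - by move=> u; exact: DF.
  - by rewrite subrr.
  - by move=> u _; rewrite expr0 mulr1 normrM (mulrC C); apply: ler_wpM2l => //; exact: fC.
have E2 t : 0 <= t -> `|F 1 t - F 1 0 - F 2 0 * h * t ^+ 1| <= C * `|h| ^+ 2 / 2 * t ^+ 2.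
  move=> t0; apply: (@derivative_growth (fun t => F 1 t - F 1 0 - F 2 0 * h * t ^+ 1)
    (fun t => h * F 2 t - F 2 0 * h * (1%:R * t ^+ 0)) (C * `|h| ^+ 2) 1) => //.
  - by move=> u; exact: (DB _ _ _ _ _ (DF 1 u _ isT) (DX u _ 1)).
  - by rewrite subrr expr0n mulr0 subr0.
  - move=> u u0; rewrite expr0 mulr1 expr1 mulr1 (mulrC (F 2 0)) -mulrBr normrM.
    have -> : C * `|h| ^+ 2 * u = `|h| * (C * `|h| * u) by ring.
    by apply: ler_wpM2l => //; exact: E3.
have E1 : `|F 0 1 - F 0 0 - F 1 0 * h * 1 ^+ 1 - F 2 0 * h ^+ 2 / 2 * 1 ^+ 2| <=
    C * `|h| ^+ 3 / 2 / 3 * 1 ^+ 3.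
  apply: (@derivative_growth (fun t => F 0 t - F 0 0 - F 1 0 * h * t ^+ 1 - F 2 0 * h ^+ 2 / 2 * t ^+ 2)
    (fun t => h * F 1 t - F 1 0 * h * (1%:R * t ^+ 0) - F 2 0 * h ^+ 2 / 2 * (2%:R * t ^+ 1))
    (C * `|h| ^+ 3 / 2) 2) => //.
  - by move=> u; exact: (DB _ _ _ _ _ (DB _ _ _ _ _ (DF 0 u _ isT) (DX u _ 1)) (DX u _ 2)).
  - by rewrite subrr !expr0n !mulr0 !subr0.
  - move=> u u0; have := E2 u u0 => E.
    have -> : h * F 1 u - F 1 0 * h * (1%:R * u ^+ 0) - F 2 0 * h ^+ 2 / 2 * (2%:R * u ^+ 1) =
      h * (F 1 u - F 1 0 - F 2 0 * h * u ^+ 1) by field.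
    have -> : C * `|h| ^+ 3 / 2 * u ^+ 2 = `|h| * (C * `|h| ^+ 2 / 2 * u ^+ 2) by field.
    by rewrite normrM ler_wpM2l.
move: E1; rewrite /F !expr1n !mulr1 !mul1r !mul0r !addr0 derive1n0.
have -> : C * `|h| ^+ 3 / 2 / 3 = C * `|h| ^+ 3 / 6 by field.
by rewrite -!mulrA.
Qed.

End taylor.

(** * Expansion in a single vector *)

Section lindeberg_expansion.
Context {R : realType} {d : measure_display} {T : measurableType d}.
Variables (P : probability T R) (m : nat) (X : nat -> 'I_m -> T -> R) (M : R).
Hypotheses (mX : forall n i, measurable_fun setT (X n i)) (iX : indep_vectors P X).
Hypotheses (X0 : forall n i, \int[P]_w X n i w = 0) (M0 : 0 <= M).
Hypothesis X3 : forall n i, L3 P (X n i) M.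
Variables (f f1 f2 : R -> R) (C : R).
Hypotheses (mf : measurable_fun setT f) (mf1 : measurable_fun setT f1)
  (mf2 : measurable_fun setT f2).
Hypotheses (fC : forall x, `|f x| <= C) (f1C : forall x, `|f1 x| <= C)
  (f2C : forall x, `|f2 x| <= C).
Hypothesis taylorC : forall a h,
  `|f (a + h) - f a - f1 a * h - f2 a * h ^+ 2 / 2| <= C * `|h| ^+ 3 / 6.

Let K := 9 / 4 * m%:R * M ^+ 2.

Lemma integ_bounded_mul (g h : T -> R) : measurable_fun setT g ->
  (forall w, `|g w| <= C) -> integ P h -> integ P (fun w => g w * h w).
Proof.
move=> mg gC ih; apply: (integ_le (measurable_funM mg (integ_measurable ih)) (integZ C (integrable_norm ih))) => w.
by rewrite normrM ler_wpM2r.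
Qed.

Lemma integ_bounded (g : T -> R) : measurable_fun setT g ->
  (forall w, `|g w| <= C) -> integ P g.
Proof. by move=> mg gC; exact: (integ_le mg (integ_cst P C)). Qed.

(** The subtracted expression involves the n-th vector only through its covariances, since the
    first-order mean is zero by independence. Two families that agree elsewhere and share these
    covariances therefore have the same main part. *)
Lemma lindeberg_expansion n p (M1 : R) : well_formed p -> 0 <= M1 ->
  (forall i, L3 P (X n i) M1) ->
  `| \int[P]_w f (polyrv X p w) - (\int[P]_w f (polyrv X (freeof n p) w) +
     2^-1 * \sum_i \sum_j (\int[P]_w (X n i w * X n j w)) *
       \int[P]_w (f2 (polyrv X (freeof n p) w) * (polyrv X (partial_deriv n i p) w * polyrv X (partial_deriv n j p) w))) |
  <= C / 6 * (M1 ^+ 3 * Num.sqrt (m%:R * \sum_i weight K (partial_deriv n i p)) ^+ 3).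
Proof.
move=> gp M10 LX; set A := polyrv X (freeof n p); set B := fun i => polyrv X (partial_deriv n i p).
have C0 : 0 <= C by exact: le_trans (normr_ge0 (f 0)) (fC 0).
have K0 : 0 <= K by rewrite /K mulr_ge0 ?sqr_ge0// mulr_ge0//; lra.
have mA : measurable_fun setT (A : obs X (predC1 n) -> R) := polyrv_obs (free_supp n (in_suppT p)).
have mB i : measurable_fun setT (B i : obs X (predC1 n) -> R) := polyrv_obs (partial_deriv_supp n i (in_suppT p)).
have mA' : measurable_fun setT A := obs_measurable_fun mX mA.
(* All indices occurring in [p], the list on which [hypercontractivity] performs its induction. *)
pose l := flatten [seq map fst t.2 | t <- p].
have suppl : in_supp (mem l) p.
  apply/allP => t tp; apply/allP => q qt; apply/flattenP; exists (map fst t.2).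
    by apply/mapP; exists t.
  by apply/mapP; exists q.
have LB i : L3 P (B i) (Num.sqrt (weight K (partial_deriv n i p))).
  apply: (hypercontractivity (l := l) mX iX X0 M0 X3 (well_formed_partial_deriv n i gp)).
  by apply: (@in_supp_partial_deriv _ _ (mem l)) suppl.
pose Y w := \sum_i X n i w * B i w.
have LY : L3 P Y (Num.sqrt (m%:R * M1 ^+ 2 * \sum_i Num.sqrt (weight K (partial_deriv n i p)) ^+ 2)).
  exact: (L3_linear_form mX iX M10 LX mB (fun i => sqrtr_ge0 _) LB).
have iY := L3_integ LY.
have iYY := L3_integM LY LY.
have [mY iY3 Y3] := LY.
have polyrvE w : polyrv X p w = A w + Y w by rewrite (polyrv_split X n gp).
have mg (g : R -> R) : measurable_fun setT g -> measurable_fun setT (fun w => g (A w)).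
  by move=> mg; exact: (measurableT_comp mg mA').
have i0 : integ P (fun w => f (A w)) by apply: integ_bounded => //; exact: mg.
have i1 : integ P (fun w => f1 (A w) * Y w) by apply: integ_bounded_mul => //; exact: mg.
have i2 : integ P (fun w => f2 (A w) * (Y w * Y w)) by apply: integ_bounded_mul => //; exact: mg.
have iQ : integ P (fun w => f (polyrv X p w)).
  have -> : (fun w => f (polyrv X p w)) = (fun w => f (A w + Y w)) by apply/funext => w; rewrite polyrvE.
  apply: integ_bounded => //; apply: (measurableT_comp mf).
  exact: measurable_funD.
have first0 : \int[P]_w (f1 (A w) * Y w) = 0.
  rewrite (_ : (fun w => _) = fun w => \sum_i X n i w * (f1 (A w) * B i w)); last first.
    by apply/funext => w; rewrite mulr_sumr; apply: eq_bigr => i _; rewrite mulrCA.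
  apply: (mean_linear_form mX iX X0 X3) => i.
    apply: measurable_funM => //; exact: (measurableT_comp mf1 mA).
  by apply: integ_bounded_mul; [exact: mg|by []|exact: L3_integ (LB i)].
have second : \int[P]_w (f2 (A w) * (Y w * Y w)) = \sum_i \sum_j
    (\int[P]_w (X n i w * X n j w)) * \int[P]_w (f2 (A w) * (B i w * B j w)).
  have iXX i j := L3_integM (LX i) (LX j).
  have iBB i j : integ P (fun w => f2 (A w) * (B i w * B j w)).
    by apply: integ_bounded_mul; [exact: mg|by []|exact: L3_integM (LB i) (LB j)].
  have ind i j : indep_pair P (fun w => X n i w * X n j w) (fun w => f2 (A w) * (B i w * B j w)).
    apply: (@coord_indep _ _ _ _ _ X mX iX n).
      by apply: measurable_funM; exact: coord_obs.
    apply: measurable_funM; first exact: (measurableT_comp mf2 mA).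
    exact: measurable_funM.
  have iprod i j := indep_integrableM (iXX i j) (iBB i j) (ind i j).
  rewrite (_ : (fun w => _) = fun w => \sum_i \sum_j
      (X n i w * X n j w) * (f2 (A w) * (B i w * B j w))); last first.
    have expand (c : R) (u : 'I_m -> R) :
        c * ((\sum_i u i) * (\sum_i u i)) = \sum_i \sum_j c * (u i * u j).
      by rewrite mulr_suml mulr_sumr; apply: eq_bigr => i _; rewrite !mulr_sumr.
    apply/funext => w; rewrite [LHS](expand _ (fun i => X n i w * B i w)).
    by apply: eq_bigr => i _; apply: eq_bigr => j _; ring.
  rewrite mean_sum; last by move=> i; apply: integ_sum => j; exact: iprod.
  apply: eq_bigr => i _; rewrite mean_sum; last by move=> j; exact: iprod.
  apply: eq_bigr => j _; apply: EFin_inj; rewrite -mean_EFin; last exact: iprod.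
  rewrite (indep_integralM (iXX i j) (iBB i j) (ind i j)) EFinM.
  by rewrite [X in (X * _)%E](mean_EFin (iXX i j)) [X in (_ * X)%E](mean_EFin (iBB i j)).
rewrite -[X in 2^-1 * X]second.
pose rem w := f (polyrv X p w) - (f (A w) + f1 (A w) * Y w + 2^-1 * (f2 (A w) * (Y w * Y w))).
have i01 := integD i0 i1; have i012 := integD i01 (integZ 2^-1 i2).
have irem : integ P rem := integB iQ i012.
have -> : \int[P]_w f (polyrv X p w) - (\int[P]_w f (A w) +
    2^-1 * \int[P]_w (f2 (A w) * (Y w * Y w))) = \int[P]_w rem w.
  rewrite /rem (RintegralB measurableT iQ i012).
  rewrite (RintegralD measurableT i01 (integZ 2^-1 i2)) (RintegralD measurableT i0 i1).
  by rewrite (RintegralZl _ measurableT i2) first0 addr0.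
apply: le_trans (le_normr_Rintegral measurableT irem) _.
apply: (@le_trans _ _ (\int[P]_w (C / 6 * `|Y w| ^+ 3))).
  apply: le_Rintegral => //; first exact: integrable_norm.
    exact: integZ.
  move=> w _; have := taylorC (A w) (Y w); rewrite /rem polyrvE.
  have -> : f (A w + Y w) - f (A w) - f1 (A w) * Y w - f2 (A w) * Y w ^+ 2 / 2 =
    f (A w + Y w) - (f (A w) + f1 (A w) * Y w + 2^-1 * (f2 (A w) * (Y w * Y w))) by field.
  by rewrite mulrAC.
rewrite (RintegralZl _ measurableT iY3); apply: ler_wpM2l; first by rewrite divr_ge0.
apply: le_trans Y3 _; rewrite -mulrA mulrCA -exprMn.
rewrite -{2}(ger0_norm M10) -(sqrtr_sqr M1) -sqrtrM ?sqr_ge0//.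
by under eq_bigr do rewrite sqr_sqrtr ?weight_ge0//.
Qed.

End lindeberg_expansion.

(** * The product space and the hybrid families *)

Section marginals.
Context {R : realType} {d1 d2 : measure_display}
  {T1 : measurableType d1} {T2 : measurableType d2}.
Variables (P1 : probability T1 R) (P2 : probability T2 R).

Definition joint : probability (T1 * T2)%type R := (P1 \x P2)%E.

Lemma joint_rect (A : set T1) (B : set T2) : measurable A -> measurable B ->
  (joint (A `*` B) = P1 A * P2 B)%E.
Proof. exact: product_measure1E. Qed.

Lemma integral_joint_fst (g : T1 -> \bar R) : measurable_fun setT g ->
  (\int[joint]_w g w.1 = \int[P1]_w g w)%E.
Proof.
have ge0 (h : T1 -> \bar R) : measurable_fun setT h -> (forall w, 0 <= h w)%E ->
    (\int[joint]_w h w.1 = \int[P1]_w h w)%E.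
  move=> mh h0; rewrite [RHS](eq_measure_integral (pushforward joint fst)).
    by rewrite ge0_integral_pushforward.
  move=> A mA _; rewrite /pushforward /=.
  have := joint_rect mA measurableT; rewrite probability_setT mule1 => <-.
  by congr (joint _); apply/seteqP; split => w //= [].
move=> mg; rewrite integralE [RHS]integralE; congr (_ - _)%E.
  rewrite -(ge0 _ (measurable_funepos mg) (funepos_ge0 g)).
  by apply: eq_integral => w _; rewrite !funeposE.
rewrite -(ge0 _ (measurable_funeneg mg) (funeneg_ge0 g)).
by apply: eq_integral => w _; rewrite !funenegE.
Qed.

Lemma integral_joint_snd (g : T2 -> \bar R) : measurable_fun setT g ->
  (\int[joint]_w g w.2 = \int[P2]_w g w)%E.
Proof.
have ge0 (h : T2 -> \bar R) : measurable_fun setT h -> (forall w, 0 <= h w)%E ->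
    (\int[joint]_w h w.2 = \int[P2]_w h w)%E.
  move=> mh h0; rewrite [RHS](eq_measure_integral (pushforward joint snd)).
    by rewrite ge0_integral_pushforward.
  move=> A mA _; rewrite /pushforward /=.
  have := joint_rect measurableT mA; rewrite probability_setT mul1e => <-.
  by congr (joint _); apply/seteqP; split => w //= [].
move=> mg; rewrite integralE [RHS]integralE; congr (_ - _)%E.
  rewrite -(ge0 _ (measurable_funepos mg) (funepos_ge0 g)).
  by apply: eq_integral => w _; rewrite !funeposE.
rewrite -(ge0 _ (measurable_funeneg mg) (funeneg_ge0 g)).
by apply: eq_integral => w _; rewrite !funenegE.
Qed.

Lemma mean_joint_fst (g : T1 -> R) : measurable_fun setT g ->
  \int[joint]_w g w.1 = \int[P1]_w g w.
Proof.
by move=> mg; rewrite /Rintegral (@integral_joint_fst (EFin \o g))//; exact/measurable_EFinP.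
Qed.

Lemma mean_joint_snd (g : T2 -> R) : measurable_fun setT g ->
  \int[joint]_w g w.2 = \int[P2]_w g w.
Proof.
by move=> mg; rewrite /Rintegral (@integral_joint_snd (EFin \o g))//; exact/measurable_EFinP.
Qed.

Lemma L3_joint_fst (g : T1 -> R) x : L3 P1 g x -> L3 joint (fun w => g w.1) x.
Proof.
move=> [mg ig gx]; split.
- exact: (measurableT_comp mg).
- move/integrableP : ig => [m_ ig]; apply/integrableP; split.
    apply/measurable_EFinP; apply: (@measurable_cube _ _ _ (fun w : T1 * T2 => g w.1)).
    exact: (measurableT_comp mg).
  apply: le_lt_trans ig.
  rewrite -(integral_joint_fst (g := fun w => `|(EFin \o (fun w => (`|g w| ^+ 3)%R)) w|%E))//.
  exact: measurableT_comp.
- by rewrite (@mean_joint_fst (fun w => `|g w| ^+ 3))//; exact: measurable_cube.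
Qed.

Lemma L3_joint_snd (g : T2 -> R) x : L3 P2 g x -> L3 joint (fun w => g w.2) x.
Proof.
move=> [mg ig gx]; split.
- exact: (measurableT_comp mg).
- move/integrableP : ig => [m_ ig]; apply/integrableP; split.
    apply/measurable_EFinP; apply: (@measurable_cube _ _ _ (fun w : T1 * T2 => g w.2)).
    exact: (measurableT_comp mg).
  apply: le_lt_trans ig.
  rewrite -(integral_joint_snd (g := fun w => `|(EFin \o (fun w => (`|g w| ^+ 3)%R)) w|%E))//.
  exact: measurableT_comp.
- by rewrite (@mean_joint_snd (fun w => `|g w| ^+ 3))//; exact: measurable_cube.
Qed.

End marginals.

Section hybrid.
Context {R : realType} {d1 d2 : measure_display}
  {T1 : measurableType d1} {T2 : measurableType d2}.
Variables (P1 : probability T1 R) (P2 : probability T2 R) (m : nat).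
Variables (Z : nat -> 'I_m -> T1 -> R) (G : nat -> 'I_m -> T2 -> R).
Hypotheses (mZ : forall n i, measurable_fun setT (Z n i))
  (mG : forall n i, measurable_fun setT (G n i)).

(** The two families live on different spaces and are combined on the product. Passing from [k] to
    [k.+1] exchanges exactly the vector of index [k]. *)
Definition hybrid (k n : nat) (i : 'I_m) (w : T1 * T2) : R :=
  if (n < k)%N then G n i w.2 else Z n i w.1.

Lemma hybrid_measurable k n i : measurable_fun setT (hybrid k n i).
Proof.
rewrite /hybrid; have [_|_] := boolP (n < k)%N.
  exact: (measurableT_comp (mG n i)).
exact: (measurableT_comp (mZ n i)).
Qed.

(** A cylinder of the hybrid family is a rectangle: a [Z]-cylinder on the indices from [k] on times
    a [G]-cylinder on those below [k]. *)
Lemma hybrid_indep k : indep_vectors P1 Z -> indep_vectors P2 G ->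
  indep_vectors (joint P1 P2) (hybrid k).
Proof.
move=> iZ iG s B us mB.
pose sG := [seq n <- s | (n < k)%N]; pose sZ := [seq n <- s | ~~ (n < k)%N].
have mcZ t : measurable (cylinder Z t B).
  apply: (cylinders_measurable mZ (S := predT)); exists (undup t), B; split => //.
  - exact: undup_uniq.
  - exact/allP.
  - by apply/seteqP; split => w /= H n; move: (H n); rewrite mem_undup.
have mcG t : measurable (cylinder G t B).
  apply: (cylinders_measurable mG (S := predT)); exists (undup t), B; split => //.
  - exact: undup_uniq.
  - exact/allP.
  - by apply/seteqP; split => w /= H n; move: (H n); rewrite mem_undup.
have cyl1 d (T : measurableType d) (X : nat -> 'I_m -> T -> R) n :
    cylinder X [:: n] B = [set w | forall i, B n i (X n i w)].
  apply/seteqP; split => w /=; first by move=> H; apply: H; rewrite mem_head.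
  by move=> H n'; rewrite inE => /eqP ->.
rewrite -cylinder_bigcap.
have -> : cylinder (hybrid k) s B = cylinder Z sZ B `*` cylinder G sG B.
  apply/seteqP; split => -[w1 w2] /=.
    move=> H; split => n; rewrite mem_filter => /andP[nk ns] i; have := H n ns i.
      by rewrite /hybrid (negbTE nk).
    by rewrite /hybrid nk.
  move=> [HZ HG] n ns i; rewrite /hybrid; case: ifPn => nk.
    by apply: HG; rewrite mem_filter nk.
  by apply: HZ; rewrite mem_filter nk.
have margG n : (n < k)%N -> (joint P1 P2 [set w | forall i, B n i (hybrid k n i w)] =
    P2 [set w | forall i, B n i (G n i w)])%E.
  move=> nk; rewrite (_ : [set w | _] = setT `*` cylinder G [:: n] B); last first.
    rewrite cyl1; apply/seteqP; split => [w H|w [_ H] i].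
      by split=> // i; have := H i; rewrite /hybrid nk.
    by rewrite /hybrid nk; exact: H.
  by rewrite joint_rect// probability_setT mul1e cyl1.
have margZ n : ~~ (n < k)%N -> (joint P1 P2 [set w | forall i, B n i (hybrid k n i w)] =
    P1 [set w | forall i, B n i (Z n i w)])%E.
  move=> nk; rewrite (_ : [set w | _] = cylinder Z [:: n] B `*` setT); last first.
    rewrite cyl1; apply/seteqP; split => [w H|w [H _] i].
      by split=> // i; have := H i; rewrite /hybrid (negbTE nk).
    by rewrite /hybrid (negbTE nk); exact: H.
  by rewrite joint_rect// probability_setT mule1 cyl1.
rewrite joint_rect// !cylinder_prod ?filter_uniq//.
rewrite [RHS](bigID (fun n => (n < k)%N)) /= muleC !big_filter.
by congr (_ * _)%E; apply: eq_bigr => n nk; [rewrite margG|rewrite margZ].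
Qed.

End hybrid.

(** * Centred Gaussian variables have mean zero *)

Section gaussian_mean.
Context {R : realType}.
Local Notation mu := (@lebesgue_measure R).

Lemma normal_probN (s : R) (A : set R) : s != 0 -> measurable A ->
  normal_prob 0 s (-%R @^-1` A) = normal_prob 0 s A.
Proof.
move=> s0 mA; rewrite /normal_prob.
have mN : measurable_fun [set: R] (-%R : R -> measurableTypeR R) by exact: oppr_measurable.
transitivity (\int[pushforward mu (-%R : R -> measurableTypeR R)]_(x in A) (normal_pdf 0 s x)%:E)%E.
  rewrite ge0_integral_pushforward//=.
  - apply: eq_integral => x _ /=; rewrite !normal_pdfE//.
    by rewrite /normal_fun !subr0 sqrrN.
  - by apply/measurable_EFinP; apply: measurable_funTS; exact: measurable_normal_pdf.
  - by move=> x _; rewrite lee_fin normal_pdf_ge0.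
by apply: eq_measure_integral => B mB _; exact: lebesgue_measureN.
Qed.

Context {d : measure_display} {T : measurableType d}.
Variable P : probability T R.

(** In the nondegenerate case Y and -Y have the same law, so the mean equals its own negative. *)
Lemma centred_gaussian_mean (Y : T -> R) : measurable_fun setT Y -> integ P Y ->
  centred_gaussian P Y -> \int[P]_w Y w = 0.
Proof.
move=> mY iY [PY0|[s [s0 law]]].
  have mY0 : measurable (Y @^-1` [set 0]) by rewrite -(setTI (Y @^-1` _)); exact: mY.
  rewrite /Rintegral (ae_eq_integral (cst 0%E))//; first by rewrite integral0.
    exact/measurable_EFinP.
  exists (~` (Y @^-1` [set 0])); split; first exact: measurableC.
    by apply: (etrans (@probability_setC _ _ _ P _ mY0)); rewrite PY0 subee.
  by move=> w /= H Yw; apply: H => _; rewrite Yw.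
have mNY : measurable_fun setT (fun w => - Y w) by exact: measurable_funN.
have iNY : integ P (fun w => - Y w).
  by apply: (integ_le mNY (integrable_norm iY)) => w; rewrite normrN.
pose YR : {RV P >-> R} := HB.pack Y (isMeasurableFun.Build _ _ _ _ Y mY).
pose NR : {RV P >-> R} := HB.pack (fun w => - Y w) (isMeasurableFun.Build _ _ _ _ _ mNY).
have same : (\int[P]_w (Y w)%:E = \int[P]_w (- Y w)%:E)%E.
  rewrite -(@integral_distribution _ _ _ _ _ P YR EFin)//.
  rewrite -(@integral_distribution _ _ _ _ _ P NR EFin)//.
  apply: eq_measure_integral => A mA _.
  rewrite /distribution /pushforward /=.
  have mNA : measurable (-%R @^-1` A : set R).
    by rewrite -(setTI (-%R @^-1` A)); exact: oppr_measurable.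
  exact: (etrans (law A mA) (esym (etrans (law _ mNA) (normal_probN (lt0r_neq0 s0) mA)))).
have E : \int[P]_w Y w = - \int[P]_w Y w.
  rewrite {1}/Rintegral same -/(Rintegral P setT (fun w => - Y w)).
  under eq_Rintegral do rewrite -mulN1r.
  by rewrite RintegralZl// mulN1r.
by lra.
Qed.

End gaussian_mean.

(** * Exchange of one vector *)

Section swap.
Context {R : realType} {d : measure_display} {T : measurableType d}.
Variables (P : probability T R) (m : nat) (M C : R) (f f1 f2 : R -> R).
Hypotheses (M0 : 0 <= M).
Hypotheses (mf : measurable_fun setT f) (mf1 : measurable_fun setT f1)
  (mf2 : measurable_fun setT f2).
Hypotheses (fC : forall x, `|f x| <= C) (f1C : forall x, `|f1 x| <= C)
  (f2C : forall x, `|f2 x| <= C).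
Hypothesis taylorC : forall a h,
  `|f (a + h) - f a - f1 a * h - f2 a * h ^+ 2 / 2| <= C * `|h| ^+ 3 / 6.

Definition admissible (X : nat -> 'I_m -> T -> R) :=
  [/\ forall n i, measurable_fun setT (X n i), indep_vectors P X,
      forall n i, \int[P]_w X n i w = 0 & forall n i, L3 P (X n i) M].

Lemma lindeberg_swap (X X' : nat -> 'I_m -> T -> R) n p (M1 M2 : R) :
  admissible X -> admissible X' -> (forall k, k != n -> X k = X' k) ->
  (forall i j, \int[P]_w (X n i w * X n j w) = \int[P]_w (X' n i w * X' n j w)) ->
  well_formed p -> 0 <= M1 -> 0 <= M2 ->
  (forall i, L3 P (X n i) M1) -> (forall i, L3 P (X' n i) M2) ->
  `| \int[P]_w f (polyrv X p w) - \int[P]_w f (polyrv X' p w) | <=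
  C / 6 * ((M1 ^+ 3 + M2 ^+ 3) *
    Num.sqrt (m%:R * \sum_i weight (9 / 4 * m%:R * M ^+ 2) (partial_deriv n i p)) ^+ 3).
Proof.
move=> [mX iX X0 X3] [mX' iX' X'0 X'3] XX' cov gp M10 M20 L1 L2.
have E := lindeberg_expansion mX iX X0 M0 X3 mf mf1 mf2 fC f1C f2C taylorC gp M10 L1.
have E' := lindeberg_expansion mX' iX' X'0 M0 X'3 mf mf1 mf2 fC f1C f2C taylorC gp M20 L2.
have QQ q : in_supp (predC1 n) q -> polyrv X' q = polyrv X q.
  move=> nq; apply/funext => w; rewrite /polyrv; apply: (evalp_ext nq) => k kn.
  by rewrite XX'.
have QA : polyrv X' (freeof n p) = polyrv X (freeof n p) by apply: QQ; exact: free_supp (in_suppT p).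
have QB i : polyrv X' (partial_deriv n i p) = polyrv X (partial_deriv n i p).
  by apply: QQ; exact: partial_deriv_supp (in_suppT p).
move: E'; rewrite QA.
under eq_bigr => i _ do under eq_bigr => j _ do rewrite -cov !QB.
move=> E'; rewrite mulrDl mulrDr.
apply: le_trans (lerD E E'); rewrite -[X in _ <= _ + X]normrN.
apply: le_trans (ler_normD _ _); rewrite le_eqVlt; apply/orP; left; apply/eqP.
by congr (`| _ |); ring.
Qed.

End swap.

(** * Counting the occurrences of an index *)

Section occurrences.
Context {R : realType} {m : nat}.
Implicit Types (p : seq (R * mindex m)) (c : mindex m -> R).

Definition occ_weight n p : R := \sum_(t <- p | n \in map fst t.2) t.1 ^+ 2.

Lemma sum_weight_partial_deriv_le K N n p : well_formed p -> 1 <= K ->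
  (forall t, t \in p -> (size t.2 <= N)%N) ->
  \sum_i weight K (partial_deriv n i p) <= K ^+ N.-1 * occ_weight n p.
Proof.
move=> gp K1 pN.
(* [F] vanishes on the terms free of [n], so [split_terms] expresses the weights of the partial
   derivatives through the original terms, one degree lower. *)
pose F (t : R * mindex m) := if n \in map fst t.2 then K ^+ (size t.2).-1 * t.1 ^+ 2 else 0.
have := @split_terms R m F (fun=> fun t => K ^+ size t.2 * t.1 ^+ 2) n p gp _.
rewrite [X in _ = X + _]big1_seq ?add0r; last first.
  by move=> t /andP[_]; rewrite mem_filter /F => /andP[/negbTE -> _].
move=> H; rewrite /weight -H; last first.
  move=> t i tp nit; rewrite /F (size_drop (well_formed_mem gp tp) nit) /=.
  by case: ifPn => // /negP[]; apply/mapP; exists (n, i).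
rewrite /occ_weight big_distrr /= [leRHS]big_mkcond /= big_seq [leRHS]big_seq.
apply: ler_sum => t tp; rewrite /F; case: ifP => // _.
apply: ler_wpM2r; first exact: sqr_ge0.
apply: ler_weXn2l => //.
by have := pN t tp; case: (size t.2) => // s; case: (N).
Qed.

Lemma sum_occ_weight_le L N p : (forall t, t \in p -> (size t.2 <= N)%N) ->
  \sum_(n < L) occ_weight n p <= N%:R * \sum_(t <- p) t.1 ^+ 2.
Proof.
move=> pN; rewrite /occ_weight.
under eq_bigr => n _ do rewrite big_mkcond.
rewrite exchange_big /= big_distrr /= big_seq [leRHS]big_seq.
apply: ler_sum => t tp; rewrite -big_mkcond /= sumr_const -[leLHS]mulr_natl.
apply: ler_wpM2r; first exact: sqr_ge0.
rewrite ler_nat (leq_trans _ (pN t tp))// -(size_map fst t.2) cardE -(size_map val).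
apply: uniq_leq_size; first by rewrite map_inj_uniq ?enum_uniq//; exact: val_inj.
by move=> k /mapP[i + ->]; rewrite mem_enum.
Qed.

Lemma occ_weight_ge0 n p : 0 <= occ_weight n p.
Proof. by apply: sumr_ge0 => t _; exact: sqr_ge0. Qed.

Variables (c : mindex m -> R) (s0 : seq (mindex m)).
Hypotheses (us0 : uniq s0) (s0P : forall a, (a \in s0) = is_mindex a && (c a != 0)).

(** [s0] lists the support of [c]; outside it the summand is zero, so a sum over infinitely many
    multi-indices becomes a list sum. *)
Lemma fsum_list (b : pred (mindex m)) (F : mindex m -> R) :
  (forall a, c a = 0 -> F a = 0) ->
  \sum_(a \in [set a | is_mindex a /\ b a]) F a = \sum_(a <- s0 | b a) F a.
Proof.
move=> F0; rewrite (fsbigE [seq a <- s0 | b a]) ?filter_uniq//.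
- rewrite big_filter_cond big_seq_cond [RHS]big_seq_cond; apply: eq_bigl => a.
  have [|//] := boolP (a \in s0); rewrite s0P /= => /andP[ia _].
  by have [ba|//] := boolP (b a); rewrite /= mem_set.
- move=> a /=; rewrite mem_filter s0P => /andP[ba /andP[ia _]] //.
- move=> a /= [ia ba]; rewrite mem_filter ba s0P ia /= negbK => /eqP; exact: F0.
Qed.

End occurrences.

(** * Comparison of constants *)

Section constants.
Variable R : realType.

Lemma bernoulli_27_25 (n : nat) : 1 + 2 / 25 * n%:R <= (27 / 25 : R) ^+ n.
Proof.
elim: n => [|n IH]; first by rewrite mulr0 addr0 expr0.
rewrite exprS -natr1; apply: le_trans (ler_wpM2l _ IH); last by lra.
have : 0 <= n%:R :> R by []. 
by lra.
Qed.

(* The example martingale gives b^3 >= 73/20 while hypercontractivity only costs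
   (3/2)^3 = 27/8 per degree: the quotient, at least 27/25, absorbs the factor N. *)
Lemma lindeberg_constant_bound (r M b : R) (N : nat) : 1 <= r -> 1 <= M -> 0 <= b -> 73 / 20 <= b ^+ 3 ->
  N%:R * r * (3 / 2 * r * M) ^+ (3 * N.-1) <= 4 * (b * r * M) ^+ (3 * N).
Proof.
move=> r1 M1 b0 b3.
have r0 : 0 <= r by lra. have M0 : 0 <= M by lra.
case: N => [|n]; first by rewrite mul0r mul0r mulr_ge0// exprn_ge0// !mulr_ge0.
rewrite /= !exprM; set X := r ^+ 3 * M ^+ 3.
have X0 : 0 <= X by rewrite /X mulr_ge0// exprn_ge0.
have -> : (3 / 2 * r * M) ^+ 3 = 27 / 8 * X by rewrite /X; field.
have -> : (b * r * M) ^+ 3 = b ^+ 3 * X by rewrite /X; ring.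
(* The spare power on the right side pays for the stray factor sqrt(m). *)
have rX : r <= X.
  rewrite /X -[leLHS]mulr1; apply: ler_pM => //; last exact: exprn_ege1.
  by rewrite -[leLHS]expr1; apply: ler_weXn2l.
have Y0 : 0 <= 27 / 8 * X by rewrite mulr_ge0//; lra.
(* Here 27/25 times 27/8 is 729/200, just below 73/20. *)
have h1 : (27 / 25) ^+ n * (27 / 8 * X) ^+ n <= (b ^+ 3 * X) ^+ n.
  rewrite -exprMn lerXn2r ?nnegrE ?mulr_ge0 ?exprn_ge0//; try lra.
  by rewrite mulrA ler_wpM2r//; lra.
have h2 := bernoulli_27_25 n.
have n0 : 0 <= n%:R :> R by [].
rewrite exprS; set U := (27 / 8 * X) ^+ n.
have U0 : 0 <= U by rewrite /U exprn_ge0.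
apply: (@le_trans _ _ (4 * (73 / 20 * X * ((27 / 25) ^+ n * U)))); last first.
  apply: ler_wpM2l => //; apply: ler_pM => //.
  - by rewrite mulr_ge0//; lra.
  - by rewrite mulr_ge0// exprn_ge0//; lra.
  - by rewrite ler_wpM2r.
have -> : 4 * (73 / 20 * X * ((27 / 25) ^+ n * U)) = 4 * (73 / 20) * X * (27 / 25) ^+ n * U by ring.
rewrite ler_wpM2r// -natr1.
(* The slope suffices: 4 times 73/20 times 2/25 is 1.168, so n + 1 is dominated. *)
apply: (@le_trans _ _ (4 * (73 / 20) * X * (1 + 2 / 25 * n%:R))).
  apply: (@le_trans _ _ ((n%:R + 1) * X)); first by rewrite ler_wpM2l//; lra.
  by rewrite [leRHS]mulrAC ler_wpM2r//; lra.
by rewrite ler_wpM2l// mulr_ge0//; lra.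
Qed.

End constants.

(** * Assembly of the bound *)

Lemma norm3inf_ub (R : realType) (f : R -> R) k x : Cb3 f -> (k <= 3)%N ->
  `|derive1n k f x| <= norm3inf f.
Proof.
move=> [_ [_ [B fB]]] k3; apply: ub_le_sup; last by exists k, x.
by exists B => _ [j [y [j3 ->]]]; exact: fB.
Qed.

Lemma derivable_measurable (R : realType) (g : R -> R) :
  (forall x, derivable g x 1) -> measurable_fun setT g.
Proof.
move=> dg; apply: continuous_measurable_fun => x.
by apply: differentiable_continuous; exact/derivable1_diffP.
Qed.

Theorem theorem2p2 (R : realType) (m : nat)
  (d1 : measure_display) (T1 : measurableType d1) (P1 : probability T1 R)
  (d2 : measure_display) (T2 : measurableType d2) (P2 : probability T2 R)
  (Z : nat -> 'I_m -> {RV P1 >-> R}) (G : nat -> 'I_m -> {RV P2 >-> R})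
  (M3Z M3G b3 : R) (c : mindex m -> R) (N : nat) (f : R -> R) :
  (0 < m)%N ->
  1 <= b3 -> burkholder3 b3 ->
  indep_vectors P1 (fun n i => Z n i) ->
  (forall n i, ('E_P1[Z n i] = 0)%E) ->
  1 <= M3Z ->
  (forall n i, (Lnorm P1 3%:E (EFin \o Z n i) <= M3Z%:E)%E) ->
  indep_vectors P2 (fun n i => G n i) ->
  (forall n, centred_gaussian_vector P2 (fun i => G n i)) ->
  (forall n i j,
     ('E_P2[fun w => (G n i w * G n j w)%R] = 'E_P1[fun w => (Z n i w * Z n j w)%R])%E) ->
  1 <= M3G ->
  (forall n i, (Lnorm P2 3%:E (EFin \o G n i) <= M3G%:E)%E) ->
  finite_set [set a : mindex m | is_mindex a /\ c a != 0] ->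
  Cb3 f ->
  let Mbar := b3 * Num.sqrt m%:R * Num.max M3Z M3G in
  let K := (2 * m%:R / 3) * (M3Z ^+ 3 + M3G ^+ 3) * Mbar ^+ (3 * N) in
  (`| 'E_P1[fun w => f (SN N c (fun n i => Z n i w))]
      - 'E_P2[fun w => f (SN N c (fun n i => G n i w))] |
    <= (K * norm3inf f * csq N c * influence c)%:E)%E.
Proof.
move=> m0 b1 burk iZ EZ MZ1 LZ iG gG EGZ MG1 LG fin fCb; cbv zeta.
pose Mbar := b3 * Num.sqrt m%:R * Num.max M3Z M3G.
pose Kpaper := (2 * m%:R / 3) * (M3Z ^+ 3 + M3G ^+ 3) * Mbar ^+ (3 * N).
pose C := norm3inf f.
have [df _] := fCb.
have mderiv k : (k < 3)%N -> measurable_fun setT (derive1n k f).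
  by move=> k3; apply: derivable_measurable => x; exact: df.
have fC k x : (k <= 3)%N -> `|derive1n k f x| <= C by exact: norm3inf_ub.
have C0 : 0 <= C by exact: le_trans (normr_ge0 _) (fC 0%N 0 isT).
have taylorC := taylor3 df (fun x => fC 3%N x isT).
have mf : measurable_fun setT f := mderiv 0%N isT.
have MZ0 : 0 <= M3Z by exact: le_trans MZ1.
have MG0 : 0 <= M3G by exact: le_trans MG1.
have mZ n i : measurable_fun setT (Z n i) by [].
have mG n i : measurable_fun setT (G n i) by [].
have L3Z n i : L3 P1 (Z n i) M3Z by exact: le_Lnorm3.
have L3G n i : L3 P2 (G n i) M3G by exact: le_Lnorm3.
have meanZ n i : \int[P1]_w Z n i w = 0.
  by have := EZ n i; rewrite unlock /Rintegral => ->.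
have meanG n i : \int[P2]_w G n i w = 0.
  apply: centred_gaussian_mean => //; first exact: L3_integ (L3G n i).
  (* The linear form with the i-th unit vector as coefficients is the i-th coordinate. *)
  have := gG n (fun j => (j == i)%:R); congr (centred_gaussian P2 _).
  apply/funext => w; rewrite (bigD1 i)//= eqxx mul1r big1 ?addr0// => j /negbTE ->.
  by rewrite mul0r.
have cov n i j : \int[P1]_w (Z n i w * Z n j w) = \int[P2]_w (G n i w * G n j w).
  by have := EGZ n i j; rewrite unlock /Rintegral => ->.
pose M := Num.max M3Z M3G.
have M1 : 1 <= M by rewrite /M le_max MZ1.
have M0 : 0 <= M by exact: le_trans M1.
have /finite_seqP[s sE] := fin; pose s0 := undup s.
have us0 : uniq s0 by exact: undup_uniq.
have s0P a : (a \in s0) = is_mindex a && (c a != 0).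
  rewrite mem_undup; apply/idP/andP => [sa|[ia ca]].
    by have : [set` s] a := sa; rewrite -sE.
  suff : [set` s] a by [].
  by rewrite -sE.
pose p := [seq (c a, a) | a <- s0 & (size a <= N)%N].
have gp : well_formed p.
  have E : map snd p = [seq a <- s0 | (size a <= N)%N] by rewrite -map_comp map_id.
  rewrite /well_formed E filter_uniq// andbT; apply/allP => a; rewrite mem_filter s0P.
  by case/and3P.
have pN t : t \in p -> (size t.2 <= N)%N.
  by case/mapP => a + ->; rewrite mem_filter => /andP[].
have SNE x : SN N c x = evalp x p.
  rewrite /SN (fsum_list us0 s0P (fun a => size a <= N)%N); last first.
    by move=> a ->; rewrite mul0r.
  by rewrite /evalp big_map big_filter.
have csqE : csq N c = \sum_(t <- p) t.1 ^+ 2.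
  rewrite /csq (fsum_list us0 s0P (fun a => size a <= N)%N); last first.
    by move=> a ->; rewrite expr0n.
  by rewrite big_map big_filter.
have occ_influence n : Num.sqrt (occ_weight n p) <= influence c.
  rewrite /influence ler_wsqrtr//.
  apply: (@le_trans _ _ (\sum_(a <- s0 | n \in map fst a) c a ^+ 2)).
    rewrite /occ_weight big_map big_filter_cond big_mkcond [leRHS]big_mkcond.
    apply: ler_sum => a _ /=; case: ifP => [/andP[_ ->]//|_].
    by case: ifP => // _; exact: sqr_ge0.
  have inflE k : \sum_(a \in [set a | is_mindex a /\ k \in map fst a]) c a ^+ 2 =
      \sum_(a <- s0 | k \in map fst a) c a ^+ 2.
    by rewrite (fsum_list us0 s0P (fun a => k \in map fst a))// => a ->; rewrite expr0n.
  apply: ub_le_sup; last by exists n.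
  (* The set must be bounded for its [sup] to be an upper bound; the full sum of squares bounds
     it. *)
  exists (\sum_(a <- s0) c a ^+ 2) => _ [k _ <-]; rewrite inflE big_mkcond.
  by apply: ler_sum => a _; case: ifP => // _; exact: sqr_ge0.
(* Past all indices of [p] the hybrid is purely Gaussian as far as [p] can see, so [L] exchanges
   suffice. *)
have [L suppL] : exists L, in_supp (fun n => n < L)%N p.
  exists (\max_(t <- p) \max_(q <- t.2) q.1).+1.
  apply/allP => t tp; apply/allP => q qt; rewrite ltnS.
  apply: (@leq_trans (\max_(q <- t.2) q.1)%N).
    exact: (@leq_bigmax_seq _ _ xpredT (fun q : nat * 'I_m => q.1)).
  exact: (@leq_bigmax_seq _ _ xpredT (fun t : R * mindex m => \max_(q <- t.2) q.1)%N).
pose H := hybrid (fun n i => Z n i : T1 -> R) (fun n i => G n i : T2 -> R).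
pose PP := joint P1 P2.
have LH k n i : L3 PP (H k n i) (if (n < k)%N then M3G else M3Z).
  rewrite /H /hybrid; have [_|_] := boolP (n < k)%N; first exact: L3_joint_snd.
  exact: L3_joint_fst.
have admH k : admissible PP M (H k).
  split.
  - by move=> n i; exact: hybrid_measurable.
  - by apply: hybrid_indep.
  - move=> n i; rewrite /H /hybrid; have [_|_] := boolP (n < k)%N.
      by rewrite (mean_joint_snd _ _ (mG n i)).
    by rewrite (mean_joint_fst _ _ (mZ n i)).
  - move=> n i; apply: L3_le (LH k n i); first by case: ifP.
    by rewrite /M le_max; case: ifP => _; rewrite lexx ?orbT.
pose e k := \int[PP]_w f (polyrv (H k) p w).
have mQ d (T : measurableType d) (X : nat -> 'I_m -> T -> R) :
    (forall n i, measurable_fun setT (X n i)) -> measurable_fun setT (fun w => f (polyrv X p w)).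
  move=> mX; apply: (measurableT_comp mf).
  exact: (obs_measurable_fun mX (polyrv_obs (in_suppT p))).
have integQ d (T : measurableType d) (P : probability T R) (X : nat -> 'I_m -> T -> R) :
    (forall n i, measurable_fun setT (X n i)) -> integ P (fun w => f (polyrv X p w)).
  move=> mX; apply: (@integ_bounded _ _ _ _ C); first exact: mQ.
  by move=> w; exact: (fC 0%N).
have e0 : e 0%N = \int[P1]_w f (SN N c (fun n i => Z n i w)).
  rewrite -(mean_joint_fst P1 P2); last first.
    by under eq_fun do rewrite SNE; exact: (mQ _ _ (fun n i => Z n i : T1 -> R)).
  by apply: eq_Rintegral => w _; rewrite SNE.
have eL : e L = \int[P2]_w f (SN N c (fun n i => G n i w)).
  rewrite -(mean_joint_snd P1 P2); last first.
    by under eq_fun do rewrite SNE; exact: (mQ _ _ (fun n i => G n i : T2 -> R)).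
  apply: eq_Rintegral => w _; rewrite SNE; congr f; apply: (evalp_ext suppL) => n nL.
  by apply/funext => i; rewrite /H /hybrid nL.
pose K := 9 / 4 * m%:R * M ^+ 2.
pose r := Num.sqrt m%:R : R.
have r0 : 0 <= r by exact: sqrtr_ge0.
have r2 : r ^+ 2 = m%:R by rewrite sqr_sqrtr.
have r1 : 1 <= r by rewrite -[leLHS]sqrtr1 ler_wsqrtr// ler1n.
pose kappa := 3 / 2 * r * M.
have K2 : K = kappa ^+ 2 by rewrite /K /kappa -r2; field.
have kappa1 : 1 <= kappa.
  rewrite /kappa; have : 1 <= r * M by rewrite -[leLHS]mulr1 ler_pM.
  by rewrite -mulrA; lra.
have K1 : 1 <= K by rewrite K2 exprn_ege1.
have kappa0 : 0 <= kappa by exact: le_trans kappa1.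
have infl0 : 0 <= influence c by exact: sqrtr_ge0.
pose c3 := C / 6 * (M3Z ^+ 3 + M3G ^+ 3).
have c30 : 0 <= c3.
  by rewrite /c3; apply: mulr_ge0; [exact: divr_ge0|rewrite addr_ge0// exprn_ge0].
have step k : `|e k - e k.+1| <=
    c3 * (r * m%:R * kappa ^+ (3 * N.-1) * influence c) * occ_weight k p.
  have sw : `|e k - e k.+1| <= C / 6 * ((M3Z ^+ 3 + M3G ^+ 3) *
      Num.sqrt (m%:R * \sum_i weight K (partial_deriv k i p)) ^+ 3).
    apply: (lindeberg_swap (f1 := derive1n 1 f) (f2 := derive1n 2 f)) => //.
    - exact: (mderiv 1%N isT).
    - exact: (mderiv 2%N isT).
    - by move=> x; exact: (fC 0%N x isT).
    - by move=> x; exact: (fC 1%N x isT).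
    - by move=> x; exact: (fC 2%N x isT).
    - move=> n nk; apply/funext => i; apply/funext => w; rewrite /H /hybrid.
      by rewrite ltnS [(n <= k)%N]leq_eqVlt (negbTE nk).
    - move=> i j; rewrite /H /hybrid ltnn ltnSn.
      rewrite (@mean_joint_fst _ _ _ _ _ P1 P2 (fun w => Z k i w * Z k j w)); last exact: measurable_funM.
      rewrite (@mean_joint_snd _ _ _ _ _ P1 P2 (fun w => G k i w * G k j w)); last exact: measurable_funM.
      exact: cov.
    - by move=> i; have := LH k k i; rewrite ltnn.
    - by move=> i; have := LH k.+1 k i; rewrite ltnSn.
  apply: le_trans sw _; rewrite mulrA -/c3 -mulrA; apply: ler_wpM2l => //.
  have o0 := occ_weight_ge0 k p.
  have rootE : Num.sqrt (m%:R * (K ^+ N.-1 * occ_weight k p)) = r * kappa ^+ N.-1 * Num.sqrt (occ_weight k p).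
    rewrite mulrA sqrtrM; last by rewrite mulr_ge0// exprn_ge0// (le_trans _ K1).
    congr (_ * _); rewrite K2 -r2 exprAC -exprMn sqrtr_sqr ger0_norm//.
    by rewrite mulr_ge0// exprn_ge0.
  apply: (@le_trans _ _ (Num.sqrt (m%:R * (K ^+ N.-1 * occ_weight k p)) ^+ 3)).
    rewrite lerXn2r ?nnegrE ?sqrtr_ge0// ler_wsqrtr// ler_wpM2l//.
    exact: sum_weight_partial_deriv_le.
  have -> : Num.sqrt (m%:R * (K ^+ N.-1 * occ_weight k p)) ^+ 3 =
      r * m%:R * kappa ^+ (3 * N.-1) * Num.sqrt (occ_weight k p) ^+ 3.
    rewrite rootE mulnC exprM -r2; move: (kappa ^+ N.-1) => u; ring.
  rewrite -[leRHS]mulrA; apply: ler_wpM2l.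
    by apply: mulr_ge0; [exact: mulr_ge0|exact: exprn_ge0].
  (* Of the three roots of [occ_weight k p], one is bounded by the influence and the other two
     restore the weight that is summed over k. *)
  by rewrite exprS sqr_sqrtr// ler_wpM2r.
have tele : `|e 0%N - e L| <= \sum_(k < L) `|e k - e k.+1|.
  elim: L {suppL eL} => [|l IH]; first by rewrite subrr normr0 big_ord0.
  rewrite big_ord_recr /= -(subrK (e l) (e 0%N)) -addrA.
  by apply: le_trans (ler_normD _ _) _; rewrite lerD2r.
have total : `|e 0%N - e L| <= Kpaper * norm3inf f * csq N c * influence c.
  apply: le_trans tele _.
  pose D := c3 * (r * m%:R * kappa ^+ (3 * N.-1) * influence c).
  apply: (@le_trans _ _ (\sum_(k < L) D * occ_weight k p)).
    by apply: ler_sum => k _; exact: step.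
  rewrite -mulr_sumr.
  have D0 : 0 <= D.
    apply: mulr_ge0 => //; apply: mulr_ge0 => //.
    by apply: mulr_ge0; [exact: mulr_ge0|exact: exprn_ge0].
  apply: le_trans (ler_wpM2l D0 (sum_occ_weight_le L pN)) _.
  rewrite -csqE /D /Kpaper -/C.
  have cb := lindeberg_constant_bound N r1 M1 (le_trans ler01 b1) (burkholder3_lower_bound (le_trans ler01 b1) burk).
  have csq0 : 0 <= csq N c by rewrite csqE; apply: sumr_ge0 => t _; exact: sqr_ge0.
  have w0 : 0 <= c3 * m%:R * influence c * csq N c.
    by apply: mulr_ge0 => //; apply: mulr_ge0 => //; exact: mulr_ge0.
  (* The 4 in [cb] turns the 1/6 inside [c3] into the 2/3 of the claim. *)
  have := ler_wpM2l w0 cb; rewrite -/kappa -/Mbar => cb'.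
  apply: le_trans (le_trans _ cb') _; rewrite le_eqVlt; apply/orP; left; apply/eqP.
    by ring.
  by rewrite /c3 /Mbar -/M -/r; field.
rewrite unlock mean_EFin; last first.
  by under eq_fun do rewrite SNE; exact: (integQ _ _ P1 (fun n i => Z n i : T1 -> R)).
rewrite mean_EFin; last first.
  by under eq_fun do rewrite SNE; exact: (integQ _ _ P2 (fun n i => G n i : T2 -> R)).
by rewrite -EFinB abse_EFin lee_fin -e0 -eL; exact: total.
Qed.
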